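(* Let $D$ be an almost alternating (classical) knot diagram. Then $u_w(D)\le c(D)-I(D)$.
   Context: Knot diagrams are classical diagrams on $S^2$. $c(D)$ is the number of crossings of $D$. A nonalternating knot diagram is almost alternating if it becomes alternating by a single crossing change. $|D|$ denotes the knot projection obtained from $D$ by forgetting the crossing information. Regions of a projection are the connected components of its complement in $S^2$; two distinct regions are disconnected if they share no crossing on their boundaries; a set of regions is isolated if any two distinct regions in it are disconnected; $I(P)$ is the maximum cardinality of an isolated set of regions of the projection $P$, and $I(D):=I(|D|)$. A welded knot diagram is a diagram obtained from a classical knot diagram by replacing some classical crossings with welded crossings (carrying no over/under information). A welded knot is an equivalence class of welded knot diagrams under classical and virtual Reidemeister moves (welded crossings playing the role of virtual crossings) and the over forbidden move (the move passing a strand that crosses over two strands across the welded crossing of those two strands). The welded unknotting number $u_w(D)$ is the minimum number of classical crossings of $D$ that need to be replaced with welded crossings to obtain a diagram of the trivial knot (as a welded knot). *)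

(* Defs.v *)
From mathcomp Require Import all_boot.
From Stdlib Require Import Relation_Operators.

Set Implicit Arguments.
Unset Strict Implicit.
Unset Printing Implicit Defensive.

(* A diagram is cut by horizontal lines into slices containing
   one critical point (local minimum [Cup], local maximum [Cap]) or one crossing
   each; every generic diagram on the sphere has this form up to isotopy. It is
   read from bottom to top, and the type K records the data carried by a
   crossing:
     unit        projections,
     bool        classical diagrams; true means that the strand running from
                 bottom left to top right is the over strand,
     option bool welded diagrams; Some b is a classical crossing and None is a
                 welded crossing. *)

Inductive shape (K : Type) : Type := Cup | Cap | Cross of K.
Arguments Cup {K}.
Arguments Cap {K}.

(* In (e, p), exactly p strands pass to the left of e. *)
Definition slice (K : Type) : Type := (shape K * nat)%type.
Definition diagram (K : Type) : Type := seq (slice K).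

Definition legs_in K (e : shape K) : nat := if e is Cup then 0 else 2.
Definition legs_out K (e : shape K) : nat := if e is Cap then 0 else 2.

Definition strands_after K (n : nat) (s : slice K) : nat :=
  n - legs_in s.1 + legs_out s.1.

(* D is a tangle diagram with m ends at the bottom and n ends at the top. *)
Fixpoint tangle K (D : diagram K) (m n : nat) : bool :=
  if D is s :: D' then
    (s.2 + legs_in s.1 <= m) && tangle D' (strands_after m s) n
  else m == n.

Definition closed K (D : diagram K) : bool := tangle D 0 0.

(* Number of strands meeting the horizontal line below slice number h. *)
Definition width K (D : diagram K) (h : nat) : nat :=
  foldl (@strands_after K) 0 (take h D).

Definition is_cross K (s : slice K) : bool :=
  if s.1 is Cross _ then true else false.

Definition crossings K (D : diagram K) : {set 'I_(size D)} :=
  [set h | is_cross (tnth (in_tuple D) h)].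

Definition crossing_number K (D : diagram K) : nat := #|crossings D|.

Definition map_shape K L (f : K -> L) (e : shape K) : shape L :=
  match e with Cup => Cup | Cap => Cap | Cross k => Cross (f k) end.

Definition recross K L (D : diagram K) (f : 'I_(size D) -> K -> L) : diagram L :=
  [seq let s := tnth (in_tuple D) h in (map_shape (f h) s.1, s.2)
     | h <- enum 'I_(size D)].

Definition projection K (D : diagram K) : diagram unit :=
  recross (fun (_ : 'I_(size D)) _ => tt).

Definition crossing_change (D : diagram bool) (h : 'I_(size D)) : diagram bool :=
  recross (fun j b => if j == h then ~~ b else b).

Definition weld (D : diagram bool) (S : {set 'I_(size D)}) :
    diagram (option bool) :=
  recross (fun j b => if j \in S then None else Some b).

(* The position (h, i, up) is the point of strand i (counted from the left) on
   the horizontal line below slice h, with up telling whether the traveller is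
   heading upwards. *)
Definition position : Type := (nat * nat * bool)%type.

Definition upside_down K (s : slice K) : slice K :=
  (match s.1 with Cup => Cap | Cap => Cup | e => e end, s.2).

(* Entering the slice s from below on strand i, the traveller leaves it on
   strand j of its top line if the result is (true, j), and of its bottom line
   if it is (false, j). *)
Definition pass K (s : slice K) (i : nat) : bool * nat :=
  let: (e, p) := s in
  if i < p then (true, i)
  else if p + legs_in e <= i then (true, i - legs_in e + legs_out e)
  else (if e is Cap then false else true, p + p.+1 - i).

Definition slice_ahead K (D : diagram K) (x : position) : option (slice K) :=
  let: (h, i, up) := x in onth D (if up then h else h.-1).

Definition travel K (D : diagram K) (x : position) : position :=
  let: (h, i, up) := x in
  if slice_ahead D x is Some s then
    let: (through, j) := pass (if up then s else upside_down s) i in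
    if through then ((if up then h.+1 else h.-1), j, up) else (h, j, ~~ up)
  else x.

(* Some true (resp. Some false) if the traveller is about to go over (resp.
   under) a crossing, None if there is no crossing in the slice ahead on the
   traveller's strand. *)
Definition passage (D : diagram bool) (x : position) : option bool :=
  let: (h, i, up) := x in
  if slice_ahead D x is Some (Cross b, p) then
    if p <= i < p.+2 then Some (b == (i == if up then p else p.+1)) else None
  else None.

Definition knot_diagram K (D : diagram K) : Prop :=
  [/\ closed D, 0 < size D &
      forall h i h' i', i < width D h -> i' < width D h' ->
        exists k, (iter k (travel D) (h, i, true)).1 = (h', i')].

Definition alternating (D : diagram bool) : Prop :=
  forall h i up, i < width D h ->
  forall k b b',
    passage D (h, i, up) = Some b ->
    (forall j, 0 < j <= k -> passage D (iter j (travel D) (h, i, up)) = None) ->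
    passage D (iter k.+1 (travel D) (h, i, up)) = Some b' ->
    b' = ~~ b.

Definition almost_alternating (D : diagram bool) : Prop :=
  [/\ knot_diagram D, ~ alternating D &
      exists2 h, h \in crossings D & alternating (crossing_change h)].

(* The horizontal line below slice h is cut by the strands into gaps; gap i lies
   just to the right of i strands. Two gaps are in the same region iff they are
   joined by a chain of gaps on consecutive lines communicating through the
   slice between them. The leftmost gap of a line and the rightmost one are
   both joined to the unique gap of the bottom line, so the outer region is a
   single one, as it is on the sphere. *)
Definition gap (P : diagram unit) : finType :=
  {h : 'I_(size P).+1 & 'I_(width P h).+1}.

Definition gaps_meet (s : slice unit) (i j : nat) : bool :=
  let: (e, p) := s in
  (i <= p) && (j == i) || (p + legs_in e <= i) && (j + legs_in e == i + legs_out e).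

Definition gap_above (P : diagram unit) (g g' : gap P) : bool :=
  if onth P (tag g) is Some s then
    (tag g' == (tag g).+1 :> nat) && gaps_meet s (tagged g) (tagged g')
  else false.

Definition same_region (P : diagram unit) : rel (gap P) :=
  connect (fun g g' => gap_above g g' || gap_above g' g).

Definition regions (P : diagram unit) : {set {set gap P}} :=
  equivalence_partition (@same_region P) [set: gap P].

(* A crossing (Cross _, p) in slice h touches gaps p, p+1, p+2 of the lines just
   below and just above it. *)
Definition gap_at_crossing (P : diagram unit) (h : 'I_(size P)) (g : gap P) : bool :=
  let p := (tnth (in_tuple P) h).2 in
  ((tag g == h :> nat) || (tag g == h.+1 :> nat)) && (p <= tagged g <= p.+2).

Definition boundary_crossings (P : diagram unit) (A : {set gap P}) :
    {set 'I_(size P)} :=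
  [set h in crossings P | [exists g in A, gap_at_crossing h g]].

Definition disconnected (P : diagram unit) (A B : {set gap P}) : bool :=
  [disjoint boundary_crossings A & boundary_crossings B].

Definition isolated (P : diagram unit) (X : {set {set gap P}}) : bool :=
  (X \subset regions P) &&
  [forall A in X, forall B in X, (A != B) ==> disconnected A B].

Definition isolation_number_proj (P : diagram unit) : nat :=
  \max_(X : {set {set gap P}} | isolated X) #|X|.

Definition isolation_number K (D : diagram K) : nat :=
  isolation_number_proj (projection D).

Definition shift K (r : nat) (D : diagram K) : diagram K :=
  [seq (s.1, s.2 + r) | s <- D].

Notation wshape := (shape (option bool)).
Notation wdiagram := (diagram (option bool)).

(* Crossing data after exchanging the roles of the rising and falling strands. *)
Definition turn (k : option bool) : option bool := omap negb k.

(* Three strands 1, 2, 3 from left to right are reversed; a, b, c are the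
   crossings of 1 and 2, of 1 and 3, of 2 and 3. A classical crossing of i < j
   has value Some true iff i is over j. *)
Definition triangle (a b c : option bool) (i : nat) : wdiagram :=
  [:: (Cross a, i); (Cross b, i.+1); (Cross c, i)].
Definition triangle' (a b c : option bool) (i : nat) : wdiagram :=
  [:: (Cross c, i.+1); (Cross b, i); (Cross a, i.+1)].

(* The first five rules generate planar isotopy. The remaining rules need only
   be given in one position in the plane, since the others follow by planar
   isotopy. *)
Inductive local_move : wdiagram -> wdiagram -> Prop :=
| Interchange (e f : wshape) p r :
    local_move [:: (e, p); (f, p + legs_out e + r)]
               [:: (f, p + legs_in e + r); (e, p)]
| Zigzag_left i : local_move [:: (Cup, i.+1); (Cap, i)] [::]
| Zigzag_right i : local_move [:: (Cup, i); (Cap, i.+1)] [::]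
| Slide_cup k i :
    local_move [:: (Cup, i); (Cross k, i.+1)] [:: (Cup, i.+1); (Cross (turn k), i)]
| Slide_cap k i :
    local_move [:: (Cross k, i.+1); (Cap, i)] [:: (Cross (turn k), i); (Cap, i.+1)]
(* Moves I and II, classical for k = Some _ and virtual for k = None. *)
| Move_I k i : local_move [:: (Cross k, i); (Cap, i)] [:: (Cap, i)]
| Move_II k i : local_move [:: (Cross k, i); (Cross (turn k), i)] [::]
(* The hypothesis says that one of the three strands is over the other two. *)
| Classical_III (a b c : bool) i :
    (a == c) ==> (b == a) ->
    local_move (triangle (Some a) (Some b) (Some c) i)
               (triangle' (Some a) (Some b) (Some c) i)
| Virtual_III i : local_move (triangle None None None i) (triangle' None None None i)
(* Strand 1, 2 or 3 passes virtually across a classical crossing. *)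
| Mixed_1 (c : bool) i :
    local_move (triangle None None (Some c) i) (triangle' None None (Some c) i)
| Mixed_2 (b : bool) i :
    local_move (triangle None (Some b) None i) (triangle' None (Some b) None i)
| Mixed_3 (a : bool) i :
    local_move (triangle (Some a) None None i) (triangle' (Some a) None None i)
(* Strand 1, 2 or 3 passes over a welded crossing. *)
| Over_forbidden_1 i :
    local_move (triangle (Some true) (Some true) None i)
               (triangle' (Some true) (Some true) None i)
| Over_forbidden_2 i :
    local_move (triangle (Some false) None (Some true) i)
               (triangle' (Some false) None (Some true) i)
| Over_forbidden_3 i :
    local_move (triangle None (Some false) (Some false) i)
               (triangle' None (Some false) (Some false) i).

Inductive welded_move : wdiagram -> wdiagram -> Prop :=
| Local (u v A B : wdiagram) :
    local_move A B -> closed (u ++ A ++ v) -> closed (u ++ B ++ v) ->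
    welded_move (u ++ A ++ v) (u ++ B ++ v)
(* Isotopy of the sphere carrying an arc of the outer region across the point at
   infinity: the two ends of T are joined by an arc on its right or on its
   left. *)
| Across_infinity (T : wdiagram) :
    tangle T 1 1 ->
    welded_move ((Cup, 0) :: rcons T (Cap, 0)) ((Cup, 0) :: rcons (shift 1 T) (Cap, 0)).

Definition welded_equivalent : wdiagram -> wdiagram -> Prop :=
  clos_refl_sym_trans wdiagram welded_move.

Definition trivial_diagram : wdiagram := [:: (Cup, 0); (Cap, 0)].

Definition welded_trivial (D : wdiagram) : Prop :=
  welded_equivalent D trivial_diagram.

Definition is_welded_unknotting_number (D : diagram bool) (u : nat) : Prop :=
  (exists S : {set 'I_(size D)},
     [/\ S \subset crossings D, #|S| = u & welded_trivial (weld S)]) /\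
  (forall S : {set 'I_(size D)},
     S \subset crossings D -> welded_trivial (weld S) -> u <= #|S|).

Lemma welded_unknotting_number_unique (D : diagram bool) (u u' : nat) :
  is_welded_unknotting_number D u -> is_welded_unknotting_number D u' -> u = u'.
Proof.
move=> [[S [sS <- tS]] minu] [[S' [sS' <- tS']] minu'].
by apply/eqP; rewrite eqn_leq minu // minu'.
Qed.

(* Main.v *)
Require Import Defs.
From mathcomp Require Import all_boot all_order all_algebra.
From mathcomp Require Import zify.
From Stdlib Require Import Relation_Operators Classical.
Import Defs.

Set Implicit Arguments.
Unset Strict Implicit.
Unset Printing Implicit Defensive.

(** Choose a maximum isolated set of regions, keep one crossing on the boundary of
    each of them, and weld all the other crossings. Isolated regions share no
    crossing, so I(D) crossings are kept and c(D) - I(D) are welded. It remains to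
    choose the kept crossings in such a way that the welded knot is trivial; as
    [u] is the least number of crossings whose welding gives the trivial knot, this
    gives the bound.

    Travel along the knot, starting with the over passage of the crossing h whose
    change makes D alternating. Call a crossing good if it is passed over before it
    is passed under ([over_first]), or if the travel meets no crossing between its
    two passages ([kink]).

    Every region has a good crossing ([region_good]). This is clear if h lies on
    its boundary. Otherwise take the crossing c of the region which is passed over
    earliest. Suppose that it is passed under first, and leave c along its under
    strand, following the boundary of the region ([boundary_under], [side_travel]).
    As D alternates away from h, the next crossing met is passed over; it lies on
    the region and, unless c is a kink, it is passed over before c is
    ([time_next]), which contradicts the choice of c.

    A set of good crossings can be welded without changing the welded knot
    ([keep_good]), thanks to [weld_crossing]: if one leaves a crossing c along its
    over strand and comes back to c along its under strand, without passing under a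
    classical crossing in between, then c may be replaced by a welded crossing. To
    see this, separate a classical crossing into a welded crossing and an arrow,
    with its tail on the over strand and its head on the under strand. By the over
    forbidden move, tails slide past each other ([tail_through]), so the tail can
    slide along the strand from c until it arrives beside its own head, where move
    I removes the arrow. Kinks satisfy the hypothesis; so does, among the kept
    crossings which are passed over first, the one passed under earliest
    ([weld_kink], [weld_over_first]).

    Finally, a knot diagram all of whose crossings are welded is trivial
    ([welded_trivial_unclassical]): its first maximum, followed downwards, meets a
    minimum, and the two disappear together unless they split off a circle
    ([bridge_slide]). The latter happens only at the end since the number of
    colourings by two colours is invariant under the moves ([colorings_eqv]), equals
    2 for a knot ([knot_colorings]), and doubles when a circle is added. *)

(** * Equivalence of tangles *)

Fixpoint wf K (A : diagram K) (m : nat) : bool :=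
  if A is s :: A' then (s.2 + legs_in s.1 <= m) && wf A' (strands_after m s)
  else true.

Definition out K (A : diagram K) (m : nat) : nat := foldl (@strands_after K) m A.

Lemma tangleE K (A : diagram K) m n : tangle A m n = wf A m && (out A m == n).
Proof. by elim: A m => [|s A IH] m //=; rewrite IH andbA. Qed.

Lemma out_cat K (A B : diagram K) m : out (A ++ B) m = out B (out A m).
Proof. exact: foldl_cat. Qed.

Lemma wf_cat K (A B : diagram K) m : wf (A ++ B) m = wf A m && wf B (out A m).
Proof. by elim: A m => [|s A IH] m //=; rewrite IH andbA. Qed.

Arguments wf : simpl never.
Arguments out : simpl never.

Lemma wf_nil K m : wf (Nil (slice K)) m = true.
Proof. by []. Qed.

Lemma wf_cup K i (A : diagram K) m : wf ((Cup, i) :: A) m = (i <= m) && wf A m.+2.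
Proof. by rewrite /wf -/(wf _ _) /strands_after /= subn0 addn0 addn2. Qed.

Lemma wf_cap K i (A : diagram K) m : wf ((Cap, i) :: A) m = (i.+2 <= m) && wf A m.-2.
Proof. by rewrite /wf -/(wf _ _) /strands_after /= subn2 addn0 addn2. Qed.

Lemma wf_cross K k i (A : diagram K) m : 2 <= m ->
  wf ((Cross k, i) :: A) m = (i.+2 <= m) && wf A m.
Proof. by move=> h; rewrite /wf -/(wf _ _) /strands_after /= subnK // addn2. Qed.

Lemma out_nil K m : out (Nil (slice K)) m = m.
Proof. by []. Qed.

Lemma out_cup K i (A : diagram K) m : out ((Cup, i) :: A) m = out A m.+2.
Proof. by rewrite /out /= /strands_after /= subn0 addn2. Qed.

Lemma out_cap K i (A : diagram K) m : out ((Cap, i) :: A) m = out A m.-2.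
Proof. by rewrite /out /= /strands_after /= subn2 addn0. Qed.

Lemma out_cross K k i (A : diagram K) m : 2 <= m ->
  out ((Cross k, i) :: A) m = out A m.
Proof. by move=> h; rewrite /out /= /strands_after /= subnK. Qed.

Lemma out_cons K (s : slice K) A m : out (s :: A) m = out A (m - legs_in s.1 + legs_out s.1).
Proof. by []. Qed.

Lemma wf_cons K (s : slice K) A m :
  wf (s :: A) m = (s.2 + legs_in s.1 <= m) && wf A (m - legs_in s.1 + legs_out s.1).
Proof. by []. Qed.

(** Discharges the typing conditions of explicit words. *)
Ltac typ :=
  rewrite ?cats0 ?cat0s /=;
  repeat first [ rewrite wf_cup /= | rewrite wf_cap /= | rewrite wf_nil
               | rewrite wf_cross; [|lia] | rewrite out_cup /= | rewrite out_cap /=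
               | rewrite out_nil | rewrite out_cross; [|lia]
               | rewrite wf_cons /= | rewrite out_cons /= ];
  lia.

Inductive tangle_move (m : nat) : wdiagram -> wdiagram -> Prop :=
| Tangle_move u A B v :
    local_move A B -> wf (u ++ A ++ v) m -> wf (u ++ B ++ v) m ->
    tangle_move m (u ++ A ++ v) (u ++ B ++ v).

(** The number of ends at the top is not fixed; the moves preserve it
    ([eqv_out]). Strands to the right of all slices do not appear in a word, so the
    same word serves for all sufficiently large [m]. *)
Definition eqv (m : nat) : wdiagram -> wdiagram -> Prop :=
  clos_refl_sym_trans _ (tangle_move m).

Lemma eqv_refl m A : eqv m A A.
Proof. exact: rst_refl. Qed.

Lemma eqv_sym m A B : eqv m A B -> eqv m B A.
Proof. exact: rst_sym. Qed.

Lemma eqv_trans m A B C : eqv m A B -> eqv m B C -> eqv m A C.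
Proof. exact: rst_trans. Qed.

Lemma local_move_out A B m :
  local_move A B -> wf A m -> wf B m -> out A m = out B m.
Proof.
case=> [e f p r|i|i|k i|k i|k i|k i|a b c i _|i|c i|b i|a i|i|i|i];
  rewrite /wf /out /= /strands_after /= => //; lia.
Qed.

(** A move keeps a tangle well formed, so that typing conditions need only be
    checked at one end of a chain of moves. *)
Lemma eqv_typ m A B : eqv m A B -> wf A m = wf B m /\ (wf A m -> out A m = out B m).
Proof.
elim=> [X Y [u A' B' v AB wA wB]|X|X Y _ [e1 e2]|X Y Z _ [e1 e2] _ [e3 e4]].
- rewrite wA wB; split=> // _; rewrite !out_cat.
  move: wA wB; rewrite !wf_cat => /and3P[_ wA _] /and3P[_ wB _].
  by rewrite (local_move_out AB).
- by [].
- by split=> [|wX]; [|rewrite e2 ?e1].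
- by split=> [|wX]; [rewrite e1|rewrite e2 // e4 // -e1].
Qed.

Lemma eqv_wf m A B : eqv m A B -> wf A m -> wf B m.
Proof. by move=> /eqv_typ[->]. Qed.

Lemma eqv_out m A B : eqv m A B -> wf A m -> out A m = out B m.
Proof. by move=> /eqv_typ[]. Qed.

Lemma eqv_catl m u A B :
  wf u m -> eqv (out u m) A B -> eqv m (u ++ A) (u ++ B).
Proof.
move=> wu; elim=> [X Y [u' A' B' v AB wA wB]|X|X Y _ e|X Y Z _ e1 _ e2].
- rewrite ![u ++ _ ++ _]catA; apply: rst_step; apply: Tangle_move => //.
  + by rewrite -catA wf_cat wu.
  + by rewrite -catA wf_cat wu.
- exact: eqv_refl.
- exact: eqv_sym.
- exact: eqv_trans e1 e2.
Qed.

Lemma eqv_catr m v A B :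
  wf v (out A m) -> eqv m A B -> eqv m (A ++ v) (B ++ v).
Proof.
case wAm: (wf A m); last first.
  move=> _ e; elim: e wAm => [X Y [u' A' B' w AB wA wB]|X|X Y XY e|X Y Z XY e1 _ e2].
  - by rewrite wA.
  - by move=> _; exact: eqv_refl.
  - by move=> wY; apply/eqv_sym/e; have [->] := eqv_typ XY.
  - by move=> wX; apply: eqv_trans (e1 wX) _; apply: e2; have [<-] := eqv_typ XY.
move=> wv e; elim: e wAm wv => [X Y [u' A' B' w AB wA wB]|X|X Y XY e|X Y Z XY e1 _ e2].
- move=> _ wv; rewrite -!catA; apply: rst_step; apply: Tangle_move => //.
  + by move: wv wA; rewrite !catA (wf_cat _ v) => -> ->.
  + have: out (u' ++ A' ++ w) m = out (u' ++ B' ++ w) m.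
      by apply: eqv_out => //; apply: rst_step.
    by move=> e; move: wv; rewrite e => wv; move: wv wB; rewrite !catA (wf_cat _ v) => -> ->.
- by move=> *; exact: eqv_refl.
- move=> wY wv; apply/eqv_sym/e; first by have [->] := eqv_typ XY.
  by rewrite (eqv_out XY) //; have [->] := eqv_typ XY.
- move=> wX wv; apply: eqv_trans (e1 wX wv) _; apply: e2.
  + by have [<-] := eqv_typ XY.
  + by rewrite -(eqv_out XY).
Qed.

Lemma eqv_ctx m u v A B :
  wf u m -> eqv (out u m) A B -> wf v (out (u ++ A) m) ->
  eqv m (u ++ A ++ v) (u ++ B ++ v).
Proof.
by move=> wu e wv; apply: eqv_catl => //; apply: eqv_catr; rewrite -?out_cat.
Qed.

Lemma eqv_move m A B : local_move A B -> wf A m -> wf B m -> eqv m A B.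
Proof.
move=> AB wA wB; rewrite -[A]cats0 -[B]cats0.
by apply: rst_step; apply: (@Tangle_move m [::]); rewrite ?cats0.
Qed.

Lemma eqv_welded A B : closed A -> eqv 0 A B -> welded_equivalent A B.
Proof.
move=> cA e; elim: e cA => [X Y [u A' B' v AB wA wB]|X|X Y XY e|X Y Z XY e1 _ e2] cX.
- have XY : eqv 0 (u ++ A' ++ v) (u ++ B' ++ v) by apply: rst_step.
  apply: rst_step; apply: Local => //.
  by move: cX; rewrite /closed !tangleE wA wB (eqv_out XY).
- exact: rst_refl.
- apply/rst_sym/e; move: cX; rewrite /closed !tangleE => /andP[wY /eqP oY].
  have wX : wf X 0 by rewrite (eqv_typ XY).1.
  by rewrite wX (eqv_out XY) // oY.
- apply: rst_trans (e1 cX) _; apply: e2; move: cX.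
  rewrite /closed !tangleE => /andP[wX /eqP oX].
  by rewrite -(eqv_out XY) // -(eqv_typ XY).1 wX oX.
Qed.

Lemma eqv_rewrite m u v A B Z :
  eqv (out u m) A B -> wf u m -> wf v (out (u ++ A) m) ->
  eqv m (u ++ B ++ v) Z -> eqv m (u ++ A ++ v) Z.
Proof. by move=> e wu wv; apply: eqv_trans; apply: eqv_ctx. Qed.

(** [rw k e] rewrites with the equivalence [e] after the k first slices of the
    left-hand side of the goal, and [rwb k e] does so from right to left. *)
Ltac rw_from k A B e :=
  match goal with |- eqv ?m ?L ?Z =>
    let u := eval cbn [take] in (take k L) in
    let n := eval cbn [size addn Nat.add] in (k + size A)%coq_nat in
    let v := eval cbn [drop] in (drop n L) in
    change (eqv m (u ++ A ++ v) Z);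
    apply: (@eqv_rewrite m u v A B Z);
    [ e | typ | typ | cbn [cat] ]
  end.
Ltac rw k e :=
  match type of e with forall m, @?P m -> eqv m ?A ?B =>
    rw_from k A B ltac:(apply: e; typ) end.
Ltac rwb k e :=
  match type of e with forall m, @?P m -> eqv m ?A ?B =>
    rw_from k B A ltac:(apply: eqv_sym; apply: e; typ) end.

(** * Local identities *)

Notation crossing k i := (@Cross (option bool) k, i).
Notation welded i := (Cross (@None bool), i).
Notation cup i := (@Cup (option bool), i).
Notation cap i := (@Cap (option bool), i).

Lemma zigzag_left i m : i.+1 <= m -> eqv m [:: (Cup, i.+1); (Cap, i)] [::].
Proof. by move=> h; apply: eqv_move; [exact: Zigzag_left|typ|]. Qed.

Lemma zigzag_right i m : i.+1 <= m -> eqv m [:: (Cup, i); (Cap, i.+1)] [::].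
Proof. by move=> h; apply: eqv_move; [exact: Zigzag_right|typ|]. Qed.

Lemma slide_cup k i m : i.+1 <= m ->
  eqv m [:: (Cup, i); crossing k i.+1] [:: (Cup, i.+1); crossing (turn k) i].
Proof. by move=> h; apply: eqv_move; [exact: Slide_cup|typ|typ]. Qed.

Lemma slide_cap k i m : i.+3 <= m ->
  eqv m [:: crossing k i.+1; (Cap, i)] [:: crossing (turn k) i; (Cap, i.+1)].
Proof. by move=> h; apply: eqv_move; [exact: Slide_cap|typ|typ]. Qed.

Lemma r1_cap k i m : i.+2 <= m -> eqv m [:: crossing k i; (Cap, i)] [:: (Cap, i)].
Proof. by move=> h; apply: eqv_move; [exact: Move_I|typ|typ]. Qed.

Lemma r2 k i m : i.+2 <= m -> eqv m [:: crossing k i; crossing (turn k) i] [::].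
Proof. by move=> h; apply: eqv_move; [exact: Move_II|typ|]. Qed.

Lemma r2v i m : i.+2 <= m -> eqv m [:: welded i; welded i] [::].
Proof. exact: (@r2 None). Qed.

(** In [vvx], [vxv] and [xvv] three strands form a triangle whose crossings, from
    the bottom slice to the top slice of the left-hand side, are welded (v) or
    arbitrary (x). They say that a strand which is welded to two others passes
    across their crossing. *)
Lemma vvx k i m : i.+3 <= m ->
  eqv m [:: welded i; welded i.+1; crossing k i] [:: crossing k i.+1; welded i; welded i.+1].
Proof.
move=> h; case: k => [b|]; apply: eqv_move; try typ.
  exact: Mixed_1.
exact: Virtual_III.
Qed.

Lemma vxv k i m : i.+3 <= m ->
  eqv m [:: welded i; crossing k i.+1; welded i] [:: welded i.+1; crossing k i; welded i.+1].
Proof.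
move=> h; case: k => [b|]; apply: eqv_move; try typ.
  exact: Mixed_2.
exact: Virtual_III.
Qed.

Lemma xvv k i m : i.+3 <= m ->
  eqv m [:: crossing k i; welded i.+1; welded i] [:: welded i.+1; welded i; crossing k i.+1].
Proof.
move=> h; case: k => [b|]; apply: eqv_move; try typ.
  exact: Mixed_3.
exact: Virtual_III.
Qed.

(** In [over1], [over2] and [over3] the strand which is over the two others starts
    on the left, in the middle and on the right. *)
Lemma over1 i m : i.+3 <= m ->
  eqv m [:: crossing (Some true) i; crossing (Some true) i.+1; welded i]
        [:: welded i.+1; crossing (Some true) i; crossing (Some true) i.+1].
Proof. by move=> h; apply: eqv_move; [exact: Over_forbidden_1|typ|typ]. Qed.

Lemma over2 i m : i.+3 <= m ->
  eqv m [:: crossing (Some false) i; welded i.+1; crossing (Some true) i]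
        [:: crossing (Some true) i.+1; welded i; crossing (Some false) i.+1].
Proof. by move=> h; apply: eqv_move; [exact: Over_forbidden_2|typ|typ]. Qed.

Lemma over3 i m : i.+3 <= m ->
  eqv m [:: welded i; crossing (Some false) i.+1; crossing (Some false) i]
        [:: crossing (Some false) i.+1; crossing (Some false) i; welded i.+1].
Proof. by move=> h; apply: eqv_move; [exact: Over_forbidden_3|typ|typ]. Qed.

Lemma far_commute (e f : wshape) p q q' m :
  [&& p + legs_out e <= q, q' + legs_out e == q + legs_in e &
      q' + legs_in f <= m] ->
  eqv m [:: (e, p); (f, q)] [:: (f, q'); (e, p)].
Proof.
move=> /and3P[hq /eqP hq' hm]; have [r qE] : exists r, q = p + legs_out e + r.
  by exists (q - (p + legs_out e)); lia.
have q'E : q' = p + legs_in e + r by lia.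
rewrite qE q'E in hm *; apply: eqv_move; [exact: Interchange|..];
  by move: hm; case: e {hq hq' qE q'E} => [||?]; case: f => [||?] /= hm; typ.
Qed.

Lemma turnK : involutive turn.
Proof. by case=> [[]|]. Qed.

Lemma slide_cupl k i m : i.+1 <= m ->
  eqv m [:: (Cup, i.+1); crossing k i] [:: (Cup, i); crossing (turn k) i.+1].
Proof. by move=> h; apply: eqv_sym; rewrite -{2}[k]turnK; apply: slide_cup. Qed.

Lemma slide_capl k i m : i.+3 <= m ->
  eqv m [:: crossing k i; (Cap, i.+1)] [:: crossing (turn k) i.+1; (Cap, i)].
Proof. by move=> h; apply: eqv_sym; rewrite -{2}[k]turnK; apply: slide_cap. Qed.

(** Move I for a minimum follows from the one for a maximum: a zigzag on the right
    leg of the cup provides a maximum, next to which the crossing can be carried. *)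
Lemma r1_cup k i m : i <= m -> eqv m [:: (Cup, i); crossing k i] [:: (Cup, i)].
Proof.
move=> h.
rwb 1 (@zigzag_right i.+1).
rwb 2 (@far_commute (Cross k) Cap i i.+2 i.+2).
rw 1 (@slide_cupl k i).
rwb 0 (@far_commute Cup Cup i i.+2 i).
rw 1 (@slide_cupl (turn k) i.+1); rewrite turnK.
rw 2 (@r1_cap k i.+2).
rw 1 (@zigzag_right i.+1); exact: eqv_refl.
Qed.

Lemma cup_under_v i m : i.+1 <= m ->
  eqv m [:: (Cup, i.+1); welded i; welded i.+1] [:: (Cup, i)].
Proof.
by move=> h; rw 0 (@slide_cupl None i); rw 1 (@r2v i.+1); exact: eqv_refl.
Qed.

Lemma cup_under_v' i m : i.+1 <= m ->
  eqv m [:: (Cup, i); welded i.+1; welded i] [:: (Cup, i.+1)].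
Proof.
by move=> h; rw 0 (@slide_cup None i); rw 1 (@r2v i); exact: eqv_refl.
Qed.

Lemma cap_under_v i m : i.+3 <= m ->
  eqv m [:: welded i; welded i.+1; (Cap, i)] [:: (Cap, i.+1)].
Proof.
by move=> h; rw 1 (@slide_cap None i); rw 0 (@r2v i); exact: eqv_refl.
Qed.

Lemma cap_under_v' i m : i.+3 <= m ->
  eqv m [:: welded i.+1; welded i; (Cap, i.+1)] [:: (Cap, i)].
Proof.
by move=> h; rw 1 (@slide_capl None i); rw 0 (@r2v i.+1); exact: eqv_refl.
Qed.

Definition typE := (out_cat, out_cons, out_nil, wf_cat, wf_cons, wf_nil).

(** * A tail travelling along a strand *)

(** An arrow with its tail on strand [i] and its head on the next strand: that
    strand crosses strand [i] and comes back; it passes under at one of the two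
    crossings, and the other one is welded. The parameter [e] is the sign of the
    arrow when strand [i] is read upwards. *)
Definition clasp (e : bool) (i : nat) : wdiagram :=
  if e then [:: crossing (Some true) i; welded i] else [:: welded i; crossing (Some false) i].

Fixpoint tail_gap (e : bool) (i d : nat) : wdiagram :=
  if d is d'.+1 then welded (i + d) :: tail_gap e i d' ++ [:: welded (i + d)]
  else clasp e i.

(** An arrow with its tail on strand [i] and its head on strand [N]: the latter
    makes a welded detour to the left in order to meet strand [i]. *)
Definition tail (e : bool) (i N : nat) : wdiagram := tail_gap e i (N - i.+1).

Arguments tail : simpl never.

Lemma tail0 e i : tail e i i.+1 = clasp e i.
Proof. by rewrite /tail subnn. Qed.

Lemma tailS e i N : i < N -> tail e i N.+1 = welded N :: tail e i N ++ [:: welded N].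
Proof.
move=> h; rewrite /tail subSn //= -/(tail_gap e i _).
by have -> : i + (N - i.+1).+1 = N by lia.
Qed.

Lemma clasp_typ e i m : i.+2 <= m -> wf (clasp e i) m /\ out (clasp e i) m = m.
Proof. by move=> h; case: e; split; typ. Qed.

Lemma tail_typ e i N m : i < N < m -> wf (tail e i N) m /\ out (tail e i N) m = m.
Proof.
elim: N => [|N IH]; first lia.
move=> /andP[]; rewrite ltnS leq_eqVlt => /orP[/eqP <-|iN] Nm.
  by rewrite tail0; apply: clasp_typ; lia.
have [w o] : wf (tail e i N) m /\ out (tail e i N) m = m by apply: IH; lia.
rewrite tailS // !typE /= (_ : m - 2 + 2 = m); last lia.
by rewrite w o /=; lia.
Qed.

Lemma tail_wf e i N m : i < N < m -> wf (tail e i N) m.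
Proof. by move=> /tail_typ-/(_ e)[]. Qed.

Lemma tail_out e i N m : i < N < m -> out (tail e i N) m = m.
Proof. by move=> /tail_typ-/(_ e)[]. Qed.

(** Discharges typing conditions in which words of known type occur. *)
Ltac tys :=
  rewrite ?typE /=;
  repeat first [ rewrite tail_out; [|lia] | rewrite tail_wf; [|lia] ]; lia.

Ltac catn := by rewrite ?cat_cons -?catA ?cat_cons ?cats0 ?cat0s -?catA ?cat_cons ?cat0s.

(** Rewrites the part [A] of the left-hand side into [B], given that the
    left-hand side is [u ++ A ++ v] up to associativity. *)
Ltac rwx u A B v :=
  match goal with |- eqv ?m ?L ?Z =>
    have -> : L = u ++ A ++ v by catn end;
  apply: (@eqv_rewrite _ u v A B); [ | tys | tys | ].

Ltac rwx_head A B v := let u := constr:(@nil (slice (option bool))) in rwx u A B v.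
Ltac rwx_last u A B := let v := constr:(@nil (slice (option bool))) in rwx u A B v.

Ltac fin := by rewrite ?cats0 /= -?catA /= ?cats0; exact: eqv_refl.

(** Slices to the left of the tail: both the tail and the head are shifted. *)
Lemma tail_left e g p i N m :
  p + legs_in g <= i < N -> N < m ->
  eqv m (tail e i N ++ [:: (g, p)])
        ((g, p) :: tail e (i - legs_in g + legs_out g) (N - legs_in g + legs_out g)).
Proof.
elim: N m => [|N IH] m; first lia.
move=> /andP[pi]; rewrite ltnS leq_eqVlt => /orP[/eqP <-|iN] Nm.
  have -> : i.+1 - legs_in g + legs_out g = (i - legs_in g + legs_out g).+1 by lia.
  rewrite !tail0; apply: eqv_sym; case: e {IH} => /=.
  - rw 0 (@far_commute g (Cross (Some true)) p (i - legs_in g + legs_out g) i).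
    rw 1 (@far_commute g (Cross None) p (i - legs_in g + legs_out g) i).
    exact: eqv_refl.
  - rw 0 (@far_commute g (Cross None) p (i - legs_in g + legs_out g) i).
    rw 1 (@far_commute g (Cross (Some false)) p (i - legs_in g + legs_out g) i).
    exact: eqv_refl.
have -> : N.+1 - legs_in g + legs_out g = (N - legs_in g + legs_out g).+1 by lia.
rewrite !tailS; [|lia..].
set i' := i - _ + _; set N' := N - _ + _.
rwx_last (welded N :: tail e i N) [:: welded N; (g, p)] [:: (g, p); welded N'].
  by apply/eqv_sym/far_commute; tys.
rwx [:: welded N] (tail e i N ++ [:: (g, p)]) ((g, p) :: tail e i' N') [:: welded N'].
  by apply: IH; rewrite ?typE /=; lia.
rwx_head [:: welded N; (g, p)] [:: (g, p); welded N'] (tail e i' N' ++ [:: welded N']).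
  by apply/eqv_sym/far_commute; tys.
fin.
Qed.

Lemma widen (A : wdiagram) m M : wf A m -> m <= M ->
  wf A M /\ out A M + m = out A m + M.
Proof.
elim: A m M => [|s A IH] m M; rewrite !typE; first lia.
move=> /andP[sm wA] mM; have [|wM oM] := IH _ (M - legs_in s.1 + legs_out s.1) wA.
  lia.
by rewrite wM; lia.
Qed.

(** A slice [f] lying to the right of all the strands that the word [A] involves. *)
Lemma word_commute (A : wdiagram) f q q' m M :
  wf A m -> m <= q' -> q' + out A m = q + m -> q' + legs_in f <= M ->
  eqv M (A ++ [:: (f, q)]) ((f, q') :: A).
Proof.
elim: A m M q q' => [|[e p] A IH] m M q q' wA mq qq qM.
  have -> : q = q' by move: qq; rewrite !typE; lia.
  exact: eqv_refl.
move: wA qq; rewrite !typE /= => /andP[pm wA] qq.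
move m1E: (m - _ + _) wA qq => m1 wA qq.
rwx_last [:: (e, p)] (A ++ [:: (f, q)]) ((f, q' - legs_in e + legs_out e) :: A).
- by apply: (IH m1); rewrite ?typE /=; lia.
rewrite cats0; set q1 := q' - _ + _; change (eqv M ([::] ++ [:: (e, p); (f, q1)] ++ A) ((f, q') :: (e, p) :: A)).
apply: (@eqv_rewrite _ _ _ _ [:: (f, q'); (e, p)]) => //.
- by apply: far_commute; rewrite ?typE /q1; lia.
- rewrite ?typE /=; apply: (proj1 (widen wA _)); rewrite /q1; lia.
exact: eqv_refl.
Qed.

(** Whether strand [i], read upwards, avoids passing under a classical crossing in
    the slice [s]. *)
Definition overpass (s : slice (option bool)) (i : nat) : bool :=
  if s.1 is Cross (Some b) then (s.2 <= i < s.2.+2) ==> (b == (i == s.2)) else true.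

(** Slices between the tail and the head are crossed by the welded part of the
    detour only ([tail_under_cup], [tail_under_cap], [tail_under_cross]). *)
Lemma tail_under_cup e p i m : i < p < m ->
  eqv m (tail e i p ++ [:: cup p]) (cup p :: tail e i p.+2).
Proof.
move=> h; apply: eqv_sym; rewrite !tailS; [|lia..].
rwx_head [:: cup p; welded p.+1; welded p] [:: cup p.+1]
  (tail e i p ++ [:: welded p; welded p.+1]).
  by apply: cup_under_v'; tys.
rwx_head ((cup p.+1) :: tail e i p) (tail e i p ++ [:: cup p.+1]) [:: welded p; welded p.+1].
  by apply/eqv_sym/(@word_commute _ _ _ _ p.+1); tys.
rwx_last (tail e i p) [:: (cup p.+1); welded p; welded p.+1] [:: cup p].
  by apply: cup_under_v; tys.
fin.
Qed.

Lemma tail_under_cap e p i m : i < p -> p.+2 < m ->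
  eqv m (tail e i p.+2 ++ [:: cap p]) (cap p :: tail e i p).
Proof.
move=> h hm; rewrite !tailS; [|lia..].
rwx_last (welded p.+1 :: welded p :: tail e i p) [:: welded p; welded p.+1; cap p]
  [:: cap p.+1].
  by apply: cap_under_v; tys.
rwx_last [:: welded p.+1; welded p] (tail e i p ++ [:: cap p.+1]) ((cap p.+1) :: tail e i p).
  by apply: (@word_commute _ _ _ _ p.+1); tys.
rwx_head [:: welded p.+1; welded p; (cap p.+1)] [:: cap p] (tail e i p).
  by apply: cap_under_v'; tys.
exact: eqv_refl.
Qed.

Lemma tail_under_cross e k p i m : i < p -> p.+2 < m ->
  eqv m (tail e i p.+2 ++ [:: crossing k p]) (crossing k p :: tail e i p.+2).
Proof.
move=> h hm; rewrite !tailS; [|lia..].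
rwx_last (welded p.+1 :: welded p :: tail e i p) [:: welded p; welded p.+1; crossing k p]
  [:: crossing k p.+1; welded p; welded p.+1].
  by apply: vvx; tys.
rwx [:: welded p.+1; welded p] (tail e i p ++ [:: crossing k p.+1])
  (crossing k p.+1 :: tail e i p) [:: welded p; welded p.+1].
  by apply: (@word_commute _ _ _ _ p.+1); tys.
rwx_head [:: welded p.+1; welded p; crossing k p.+1] [:: crossing k p; welded p.+1; welded p]
  (tail e i p ++ [:: welded p; welded p.+1]).
  by apply/eqv_sym/xvv; tys.
fin.
Qed.

(** The tail itself passes a crossing: if strand [p] is over, this is the over
    forbidden move, and if the crossing is welded, a mixed or virtual one. *)
Lemma tail_over_left e k p m : p.+2 < m -> k != Some false ->
  eqv m (tail e p p.+2 ++ [:: crossing k p]) (crossing k p :: tail e p.+1 p.+2).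
Proof.
move=> hm hk; rewrite (@tailS e p p.+1) // !tail0.
case: k hk => [[]|] // _; case: e => /=.
- rw 2 (@vvx (Some true) p).
  rwb 0 (@over1 p).
  rw 2 (@r2v p). exact: eqv_refl.
- rw 2 (@over2 p).
  rwb 0 (@xvv (Some true) p).
  rw 2 (@r2v p). exact: eqv_refl.
- rw 2 (@vvx None p).
  rwb 0 (@vxv (Some true) p).
  rw 2 (@r2v p). exact: eqv_refl.
- rw 2 (@xvv (Some false) p).
  rwb 0 (@vvx None p).
  rw 2 (@r2v p). exact: eqv_refl.
Qed.

Lemma tail_over_right e k p m : p.+2 < m -> k != Some true ->
  eqv m (tail e p.+1 p.+2 ++ [:: crossing k p]) (crossing k p :: tail e p p.+2).
Proof.
move=> hm hk; rewrite (@tailS e p p.+1) // !tail0.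
apply: eqv_sym; case: k hk => [[]|] // _; case: e => /=.
- rw 0 (@over2 p).
  rw 1 (@vxv (Some false) p).
  rw 3 (@r2v p.+1). exact: eqv_refl.
- rw 0 (@xvv (Some false) p).
  rw 1 (@over3 p).
  rw 3 (@r2v p.+1). exact: eqv_refl.
- rw 0 (@vvx (Some true) p).
  rw 1 (@vvx None p).
  rw 3 (@r2v p.+1). exact: eqv_refl.
- rw 0 (@vxv None p).
  rwb 2 (@vxv (Some false) p).
  rw 1 (@r2v p). exact: eqv_refl.
Qed.

(** The tail may be left of the slice or in it, and the slice may be left of the
    head by any amount; when the head is further to the right than necessary, its
    first and last welded crossings commute with the slice. *)
Lemma tail_through e (s : slice (option bool)) i j N m :
  pass s i = (true, j) -> overpass s i -> s.2 + legs_in s.1 <= N -> i < N < m ->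
  eqv m (tail e i N ++ [:: s]) (s :: tail e j (N - legs_in s.1 + legs_out s.1)).
Proof.
case: s => g p /= hp ov hN him.
case: (leqP (p + legs_in g) i) => hi.
  move: hp; rewrite ltnNge (leq_trans _ hi) ?leq_addr //= hi => -[<-].
  by apply: tail_left; lia.
elim: N m hN him => [|N IH] m; first lia.
rewrite leq_eqVlt ltnS => /orP[/eqP NE|hN] him; last first.
  have jN : j < N - legs_in g + legs_out g.
    clear -hp hN hi him; move: hp hN hi; case: g => [||k] /=; case: ltnP => ?;
      try case: leqP => ?; case=> //; lia.
  have -> : N.+1 - legs_in g + legs_out g = (N - legs_in g + legs_out g).+1 by lia.
  rewrite !tailS; [|lia..].
  set N' := N - _ + _ in jN *.
  rwx_last (welded N :: tail e i N) [:: welded N; (g, p)] [:: (g, p); welded N'].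
    by apply/eqv_sym/far_commute; tys.
  rwx [:: welded N] (tail e i N ++ [:: (g, p)]) ((g, p) :: tail e j N') [:: welded N'].
    by apply: IH; rewrite ?typE /=; lia.
  rwx_head [:: welded N; (g, p)] [:: (g, p); welded N'] (tail e j N' ++ [:: welded N']).
    by apply/eqv_sym/far_commute; tys.
  fin.
clear IH; move: hp ov; rewrite -NE /pass /overpass /=; case: ltnP => ip.
  case=> <- _; case: g hi NE => [||k] /= hi NE.
  - by rewrite addn0 subn0 addn2; apply: tail_under_cup; lia.
  - by rewrite addn2 addn0 subn2 /=; apply: tail_under_cap; lia.
  - by rewrite addn2 subn2 /= addn2; apply: tail_under_cross; lia.
rewrite leqNgt hi /=; case: g hi NE => [||k] /= hi NE; [lia| |].
  by case.
case=> <-; rewrite addn2 subn2 /= addn2.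
have [->|->] : i = p \/ i = p.+1 by lia.
  rewrite addKn => hk; apply: tail_over_left; first lia.
  by move: hk; case: k => [[]|] //=; lia.
rewrite addnK => hk; apply: tail_over_right; first lia.
by move: hk; case: k => [[]|] //=; lia.
Qed.

(** On the two legs of a minimum or a maximum the tail strand is read in opposite
    directions, hence the change of sign. *)
Lemma tail_turn_cup e p N m : p.+1 < N < m.+2 -> p <= m ->
  eqv m ((Cup, p) :: tail e p N) ((Cup, p) :: tail (~~ e) p.+1 N).
Proof.
elim: N => [|N IH]; first lia.
rewrite ltnS leq_eqVlt => /andP[/orP[/eqP <-|hN] Nm] hm.
  rewrite (@tailS e p p.+1) // !tail0; case: e {IH} => /=.
  - rwb 0 (@r1_cup None p).
    rw 1 (@vvx (Some true) p).
    rw 2 (@vxv None p).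
    rw 4 (@r2v p.+1).
    rw 0 (@slide_cup (Some true) p).
    rw 1 (@xvv (Some false) p).
    rw 0 (@r1_cup None p.+1).
    rwb 0 (@slide_cup None p).
    exact: eqv_refl.
  - rw 0 (@slide_cup None p).
    rw 1 (@r2v p).
    rwb 0 (@slide_cup (Some true) p).
    exact: eqv_refl.
rewrite !tailS; [|lia..].
rwx_head [:: cup p; welded N] [:: welded N.-2; cup p] (tail e p N ++ [:: welded N]).
  by apply: far_commute; tys.
rwx [:: welded N.-2] (cup p :: tail e p N) (cup p :: tail (~~ e) p.+1 N) [:: welded N].
  have -> : out [:: welded N.-2] m = m by tys.
  by apply: IH; lia.
rwx_head [:: welded N.-2; cup p] [:: cup p; welded N] (tail (~~ e) p.+1 N ++ [:: welded N]).
  by apply/eqv_sym/far_commute; tys.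
fin.
Qed.

Lemma tail_turn_cap e p N m : p.+1 < N < m ->
  eqv m (tail e p N ++ [:: (Cap, p)]) (tail (~~ e) p.+1 N ++ [:: (Cap, p)]).
Proof.
elim: N m => [|N IH] m; first lia.
rewrite ltnS leq_eqVlt => /andP[/orP[/eqP <-|hN] Nm].
  rewrite (@tailS e p p.+1) // !tail0; case: e {IH} => /=.
  - rw 3 (@slide_cap None p).
    rw 2 (@r2v p).
    rw 1 (@slide_capl (Some true) p).
    exact: eqv_refl.
  - rwb 4 (@r1_cap None p).
    rw 2 (@xvv (Some false) p).
    rwb 0 (@vxv None p).
    rw 2 (@r2v p).
    rw 2 (@slide_cap (Some false) p).
    rw 0 (@vvx (Some true) p).
    rw 2 (@r1_cap None p.+1).
    rw 1 (@slide_capl None p).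
    exact: eqv_refl.
rewrite !tailS; [|lia..].
rwx_last (welded N :: tail e p N) [:: welded N; cap p] [:: cap p; welded N.-2].
  by apply/eqv_sym/far_commute; tys.
rwx [:: welded N] (tail e p N ++ [:: cap p]) (tail (~~ e) p.+1 N ++ [:: cap p]) [:: welded N.-2].
  by apply: IH; rewrite ?typE /=; lia.
rwx_last (welded N :: tail (~~ e) p.+1 N) [:: cap p; welded N.-2] [:: welded N; cap p].
  by apply: far_commute; tys.
fin.
Qed.

(** * Welding a crossing *)

(** [d] counts the strands between the crossing and the exchanged strand. *)
Fixpoint jog_gap (b : bool) (p d : nat) : wdiagram :=
  if d is d'.+1 then welded (p.+2 + d') :: jog_gap b p d' ++ [:: welded (p.+2 + d')]
  else if b then [:: welded p.+1; welded p] else [:: welded p; welded p.+1].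

(** In place of a crossing of type [b] of strands [p] and [p.+1], its over strand
    goes on as it did, while its under strand and the strand at position [n]
    exchange their upper halves; all crossings are welded. Closing the strand [n]
    by a cup and a cap gives back a welded crossing, with a detour of its under
    strand ([jog_straight]). *)
Definition jog (b : bool) (p n : nat) : wdiagram := jog_gap b p (n - p.+2).

Arguments jog : simpl never.

Lemma jog0 b p : jog b p p.+2 = if b then [:: welded p.+1; welded p] else [:: welded p; welded p.+1].
Proof. by rewrite /jog subnn. Qed.

Lemma jogS b p n : p.+2 <= n -> jog b p n.+1 = welded n :: jog b p n ++ [:: welded n].
Proof.
move=> h; rewrite /jog subSn //= -/(jog_gap b p _).
by rewrite subnKC.
Qed.

Lemma jog_typ b p n m : p.+2 <= n < m -> wf (jog b p n) m /\ out (jog b p n) m = m.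
Proof.
elim: n => [|n IH]; first lia.
rewrite leq_eqVlt ltnS => /andP[/orP[/eqP [<-]|pn] nm].
  by rewrite jog0; case: b {IH}; split; typ.
have [w o] : wf (jog b p n) m /\ out (jog b p n) m = m by apply: IH; lia.
rewrite jogS // !typE /= (_ : m - 2 + 2 = m); last lia.
by rewrite w o /=; lia.
Qed.

Lemma jog_wf b p n m : p.+2 <= n < m -> wf (jog b p n) m.
Proof. by move=> /jog_typ-/(_ b)[]. Qed.

Lemma jog_out b p n m : p.+2 <= n < m -> out (jog b p n) m = m.
Proof. by move=> /jog_typ-/(_ b)[]. Qed.

Lemma clasp_wf e i m : i.+2 <= m -> wf (clasp e i) m.
Proof. by move=> /clasp_typ-/(_ e)[]. Qed.

Lemma clasp_out e i m : i.+2 <= m -> out (clasp e i) m = m.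
Proof. by move=> /clasp_typ-/(_ e)[]. Qed.

Ltac tys ::=
  rewrite ?typE /=;
  repeat first [ rewrite tail_out; [|lia] | rewrite tail_wf; [|lia]
               | rewrite jog_out; [|lia] | rewrite jog_wf; [|lia]
               | rewrite clasp_out; [|lia] | rewrite clasp_wf; [|lia] ]; lia.

(** Case analysis on the innermost tests, closed by linear arithmetic. *)
Ltac ifs :=
  repeat match goal with |- context [if ?c then _ else _] =>
    lazymatch c with
    | context [if _ then _ else _] => fail
    | _ => case: (boolP c) => ?
    end end; lia.

Definition swap (q i : nat) : nat :=
  if i < q then i else if q.+2 <= i then i else q + q.+1 - i.

Lemma tail_v e q i N m : q.+2 <= N -> i < N < m ->
  eqv m (tail e i N ++ [:: welded q]) (welded q :: tail e (swap q i) N).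
Proof.
move=> qN im; have {2}-> : N = N - 2 + 2 by lia.
apply: (@tail_through e (welded q)) => //=; last lia.
rewrite /swap addn2; case: ltnP => // _; case: leqP => // h.
by rewrite subnK // (leq_trans _ h).
Qed.

(** The strand on which a tail below the jog arrives above it. *)
Definition jog_pos (b : bool) (p n i : nat) : nat :=
  if i == n then (if b then p else p.+1)
  else if i == (if b then p else p.+1) then (if b then p.+1 else p)
  else if i == (if b then p.+1 else p) then n else i.

(** The jog is welded, so every tail slides through it. *)
Lemma tail_jog e b p n i N m : p.+2 <= n -> i < N -> n < N < m ->
  eqv m (tail e i N ++ jog b p n) (jog b p n ++ tail e (jog_pos b p n i) N).
Proof.
elim: n i => [|n IH] i; first lia.
rewrite leq_eqVlt ltnS => /orP[/eqP [nE]|pn] iN nN.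
  rewrite -nE in iN nN *; rewrite jog0.
  have sE : jog_pos b p p.+2 i =
     if b then swap p (swap p.+1 i) else swap p.+1 (swap p i).
    by clear IH; rewrite /jog_pos /swap; case: b; ifs.
  rewrite {}sE; case: b {IH} => /=.
  - have h : swap p.+1 i < N by rewrite /swap; ifs.
    rwx_head (tail e i N ++ [:: welded p.+1]) (welded p.+1 :: tail e (swap p.+1 i) N) [:: welded p].
      by apply: tail_v; tys.
    rwx_last [:: welded p.+1] (tail e (swap p.+1 i) N ++ [:: welded p])
      (welded p :: tail e (swap p (swap p.+1 i)) N).
      by apply: tail_v; tys.
    fin.
  - have h : swap p i < N by rewrite /swap; ifs.
    rwx_head (tail e i N ++ [:: welded p]) (welded p :: tail e (swap p i) N) [:: welded p.+1].
      by apply: tail_v; tys.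
    rwx_last [:: welded p] (tail e (swap p i) N ++ [:: welded p.+1])
      (welded p.+1 :: tail e (swap p.+1 (swap p i)) N).
      by apply: tail_v; tys.
    fin.
have sE : jog_pos b p n.+1 i = swap n (jog_pos b p n (swap n i)).
  by clear IH; rewrite /jog_pos /swap; case: b; ifs.
have h1 : swap n i < N by rewrite /swap; ifs.
have h2 : jog_pos b p n (swap n i) < N.
  by clear IH sE; rewrite /jog_pos; case: b; ifs.
rewrite sE !jogS //; set j := swap n i in h1 h2 *; set k := jog_pos b p n j in h2 *.
rwx_head (tail e i N ++ [:: welded n]) (welded n :: tail e j N) (jog b p n ++ [:: welded n]).
  by apply: tail_v; tys.
rwx [:: welded n] (tail e j N ++ jog b p n) (jog b p n ++ tail e k N) [:: welded n].
  rewrite (_ : out _ _ = m); last tys.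
  by apply: IH; lia.
rwx_last (welded n :: jog b p n) (tail e k N ++ [:: welded n]) (welded n :: tail e (swap n k) N).
  rewrite (_ : out _ _ = m); last tys.
  by apply: tail_v; tys.
fin.
Qed.

(** An arrow from a strand to its neighbour across a cup or a cap consists of two
    curls, each removed by move I. *)
Lemma cup_clasp e n m : n <= m -> eqv m ((Cup, n) :: clasp e n) [:: (Cup, n)].
Proof.
move=> h; case: e => /=.
  rw 0 (@r1_cup (Some true) n); rw 0 (@r1_cup None n); exact: eqv_refl.
rw 0 (@r1_cup None n); rw 0 (@r1_cup (Some false) n); exact: eqv_refl.
Qed.

Lemma clasp_cap e n m : n.+2 <= m -> eqv m (clasp e n ++ [:: (Cap, n)]) [:: (Cap, n)].
Proof.
move=> h; case: e => /=.
  rw 1 (@r1_cap None n); rw 0 (@r1_cap (Some true) n); exact: eqv_refl.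
rw 1 (@r1_cap (Some false) n); rw 0 (@r1_cap None n); exact: eqv_refl.
Qed.

(** Without a tail the jog is a welded detour of the under strand, which can be
    pulled straight. *)
Lemma jog_straight b p n m : p.+2 <= n <= m ->
  eqv m ((Cup, n) :: jog b p n ++ [:: (Cap, n)]) [:: welded p].
Proof.
elim: n m => [|n IH] m; first lia.
rewrite leq_eqVlt ltnS => /andP[/orP[/eqP [<-]|pn] nm].
  rewrite jog0; case: b {IH} => /=.
  - rw 0 (@slide_cupl None p.+1).
    rwb 1 (@far_commute (Cross None) (Cross None) p p.+2 p.+2).
    rw 2 (@r1_cap None p.+2).
    rw 1 (@far_commute (Cross None) Cap p p.+2 p.+2).
    rw 0 (@zigzag_right p.+1). exact: eqv_refl.
  - rwb 0 (@far_commute (Cross None) Cup p p.+2 p.+2).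
    rw 1 (@slide_cupl None p.+1).
    rw 2 (@r1_cap None p.+2).
    rw 1 (@zigzag_right p.+1). exact: eqv_refl.
rewrite jogS //.
rwx_head [:: (cup n.+1); welded n] [:: (cup n); welded n.+1]
  (jog b p n ++ [:: welded n; (cap n.+1)]).
  by apply: slide_cupl; tys.
rwx_last ((cup n) :: welded n.+1 :: jog b p n) [:: welded n; (cap n.+1)] [:: welded n.+1; (cap n)].
  by apply: slide_capl; tys.
rwx [:: (cup n)] (welded n.+1 :: jog b p n) (jog b p n ++ [:: welded n.+1])
  [:: welded n.+1; (cap n)].
  by apply/eqv_sym/(@word_commute _ _ _ _ n.+1); tys.
rwx ((cup n) :: jog b p n) [:: welded n.+1; welded n.+1] (@nil (slice (option bool))) [:: (cap n)].
  by apply: r2v; tys.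
apply: eqv_trans (IH m _); last lia.
fin.
Qed.

(** With a tail on the over strand just above it, the jog is the original
    crossing. *)
Lemma jog_tail_cross b p n m : p.+2 <= n <= m ->
  eqv m ((Cup, n) :: jog b p n ++ tail (~~ b) (if b then p.+1 else p) n.+1 ++ [:: (Cap, n)])
        [:: crossing (Some b) p].
Proof.
elim: n m => [|n IH] m; first lia.
rewrite leq_eqVlt ltnS => /andP[/orP[/eqP [<-]|pn] nm].
  rewrite jog0; case: b {IH} => /=.
  - rewrite tailS // tail0 /=.
    rw 6 (@r1_cap None p.+2).
    rw 0 (@slide_cupl None p.+1).
    rwb 1 (@far_commute (Cross None) (Cross None) p p.+2 p.+2).
    rw 2 (@r2v p.+2).
    rw 3 (@slide_capl (Some false) p.+1).
    rw 0 (@slide_cupl None p).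
    rw 1 (@r2v p.+1).
    rw 0 (@far_commute Cup (Cross (Some true)) p p.+2 p).
    rw 1 (@zigzag_right p). exact: eqv_refl.
  - rewrite (@tailS _ p p.+2) // (@tailS _ p p.+1) // tail0 /=.
    rw 8 (@r1_cap None p.+2).
    rw 2 (@vxv None p.+1).
    rw 1 (@far_commute (Cross None) (Cross None) p p.+2 p.+2).
    rw 0 (@r1_cup None p.+2).
    rwb 3 (@far_commute (Cross (Some true)) (Cross None) p p.+2 p.+2).
    rwb 4 (@far_commute (Cross None) (Cross None) p p.+2 p.+2).
    rw 5 (@cap_under_v' p.+1).
    rwb 0 (@far_commute (Cross None) Cup p p.+2 p.+2).
    rw 1 (@slide_cupl None p.+1).
    rwb 2 (@far_commute (Cross (Some true)) (Cross None) p p.+2 p.+2).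
    rwb 3 (@far_commute (Cross None) (Cross None) p p.+2 p.+2).
    rw 4 (@slide_cap None p.+1).
    rw 1 (@slide_cupl (Some true) p).
    rwb 2 (@vvx (Some false) p).
    rw 1 (@r1_cup None p).
    rw 3 (@far_commute (Cross (Some false)) Cap p p.+2 p.+2).
    rw 1 (@slide_cup None p).
    rw 2 (@far_commute (Cross None) Cap p p.+2 p.+2).
    rw 1 (@zigzag_right p.+1).
    rw 0 (@r2v p). exact: eqv_refl.
set i := if b then _ else _ in IH *; set e := ~~ b in IH *.
have ip : i < p.+2 by rewrite /i; case: (b).
rewrite tailS; last lia.
rewrite tailS; last lia.
rewrite jogS //.
set C0 := (cup n.+1); set C1 := (cap n.+1).
rwx (C0 :: welded n :: jog b p n) [:: welded n; welded n.+1; welded n]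
  [:: welded n.+1; welded n; welded n.+1] (tail e i n ++ [:: welded n; welded n.+1; C1]).
  by apply: vxv; tys.
rwx (C0 :: welded n :: jog b p n ++ [:: welded n.+1; welded n]) (welded n.+1 :: tail e i n)
  (tail e i n ++ [:: welded n.+1]) [:: welded n; welded n.+1; C1].
  by apply/eqv_sym/(@word_commute _ _ _ _ n.+1); tys.
rwx (C0 :: welded n :: jog b p n ++ welded n.+1 :: welded n :: tail e i n)
  [:: welded n.+1; welded n; welded n.+1] [:: welded n; welded n.+1; welded n] [:: C1].
  by apply/eqv_sym/(@vxv None); tys.
rwx (C0 :: welded n :: jog b p n ++ welded n.+1 :: welded n :: tail e i n ++ [:: welded n])
  [:: welded n.+1; welded n; C1] [:: (cap n)] (@nil (slice (option bool))).
  by apply: cap_under_v'; tys.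
rwx [:: C0; welded n] (jog b p n ++ [:: welded n.+1]) (welded n.+1 :: jog b p n)
  (welded n :: tail e i n ++ [:: welded n; (cap n)]).
  by apply/(@word_commute _ _ _ _ n.+1); tys.
rwx_head [:: C0; welded n; welded n.+1] [:: (cup n)]
  (jog b p n ++ welded n :: tail e i n ++ [:: welded n; (cap n)]).
  by apply/cup_under_v; tys.
apply: eqv_trans (IH m _); last lia.
rewrite tailS; last lia.
fin.
Qed.

(** A tail of any sign on the under strand, reached from above or from below,
    can be pulled to the strand with its head, where it is removed by moves I. *)
Lemma jog_tail_above b e p n m : p.+2 <= n <= m ->
  eqv m ((Cup, n) :: jog b p n ++ tail e (if b then p else p.+1) n.+1 ++ [:: (Cap, n)])
        [:: welded p].
Proof.
move=> h; move iE: (if b then _ else _) => i.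
have ip : i < p.+2 by rewrite -iE; case: (b).
have {iE} jE : eqv m.+2 (tail e n n.+1 ++ jog b p n) (jog b p n ++ tail e i n.+1).
  have <- : jog_pos b p n n = i by rewrite /jog_pos eqxx.
  by apply: tail_jog; lia.
rwx [:: (cup n)] (jog b p n ++ tail e i n.+1) (tail e n n.+1 ++ jog b p n) [:: (cap n)].
  by rewrite out_cup; exact: eqv_sym.
rewrite tail0.
rwx_head ((cup n) :: clasp e n) [:: (cup n)] (jog b p n ++ [:: (cap n)]).
  by apply: cup_clasp; tys.
exact: jog_straight.
Qed.

Lemma jog_tail_below b e p n m : p.+2 <= n <= m ->
  eqv m ((Cup, n) :: tail e (if b then p.+1 else p) n.+1 ++ jog b p n ++ [:: (Cap, n)])
        [:: welded p].
Proof.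
move=> h; move iE: (if b then _ else _) => i.
have ip : i < p.+2 by rewrite -iE; case: (b).
have {iE} jE : eqv m.+2 (tail e i n.+1 ++ jog b p n) (jog b p n ++ tail e n n.+1).
  have jE : jog_pos b p n i = n by rewrite /jog_pos -iE; case: (b); ifs.
  by have := @tail_jog e b p n i n.+1 m.+2; rewrite jE; apply; lia.
rwx [:: (cup n)] (tail e i n.+1 ++ jog b p n) (jog b p n ++ tail e n n.+1) [:: (cap n)].
  by rewrite out_cup.
rewrite tail0.
rwx_last ((cup n) :: jog b p n) (clasp e n ++ [:: (cap n)]) [:: (cap n)].
  by apply: clasp_cap; tys.
apply: eqv_trans (@jog_straight b p n m _); last lia.
fin.
Qed.

Lemma widthE K (D : diagram K) h : width D h = out (take h D) 0.
Proof. by []. Qed.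

Lemma onth_lt T (D : seq T) k s : onth D k = Some s -> k < size D.
Proof. by move=> h; rewrite -onthTE h. Qed.

Lemma take_onth T (D : seq T) k s : onth D k = Some s -> take k.+1 D = rcons (take k D) s.
Proof.
move=> h; rewrite (take_nth s) ?(onth_lt h) //.
by rewrite -(odflt_onth s) h.
Qed.

Lemma widthS K (D : diagram K) k s : onth D k = Some s ->
  width D k.+1 = strands_after (width D k) s.
Proof. by move=> h; rewrite /width (take_onth h) foldl_rcons. Qed.

Lemma onth_fits K (D : diagram K) k s : wf D 0 -> onth D k = Some s ->
  s.2 + legs_in s.1 <= width D k.
Proof.
move=> wD h; move: wD; rewrite -{1}(cat_take_drop k D) wf_cat => /andP[_].
by rewrite (drop_nth s) ?(onth_lt h) // -(odflt_onth s) h wf_cons => /andP[].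
Qed.

(** What slice k becomes when the crossing (Some b, p) of slice h is replaced by a
    jog. *)
Definition block (W : wdiagram) (h : nat) (b : bool) (p k : nat) : wdiagram :=
  if k == h then jog b p (width W h) else seq_of_opt (onth W k).

Definition blocks W h b p k l : wdiagram :=
  flatten [seq block W h b p j | j <- iota k l].

Lemma blocksS W h b p k l :
  blocks W h b p k l.+1 = block W h b p k ++ blocks W h b p k.+1 l.
Proof. by []. Qed.

Lemma blocks_cat W h b p k l l' :
  blocks W h b p k (l + l') = blocks W h b p k l ++ blocks W h b p (k + l) l'.
Proof. by rewrite /blocks iotaD map_cat flatten_cat. Qed.

Lemma block_typ W h b p k : wf W 0 -> onth W h = Some (crossing (Some b) p) ->
  k < size W ->
  wf (block W h b p k) (width W k).+2 /\
  out (block W h b p k) (width W k).+2 = (width W k.+1).+2.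
Proof.
move=> wW hW kW; have fh := onth_fits wW hW; rewrite /= in fh.
rewrite /block; case: eqP => [->|_].
  rewrite (widthS hW) /strands_after /=.
  by rewrite jog_wf ?jog_out; lia.
case sE: (onth W k) (onthTE W k) => [s|]; rewrite ?kW // => _.
have fs := onth_fits wW sE.
by rewrite /= !typE (widthS sE) /strands_after; lia.
Qed.

Lemma blocks_typ W h b p k l : wf W 0 -> onth W h = Some (crossing (Some b) p) ->
  k + l <= size W ->
  wf (blocks W h b p k l) (width W k).+2 /\
  out (blocks W h b p k l) (width W k).+2 = (width W (k + l)).+2.
Proof.
move=> wW hW; elim: l k => [|l IH] k kl; first by rewrite addn0.
rewrite blocksS !typE; have [|-> ->] := block_typ wW hW (k := k); first lia.
by have [|-> ->] := IH k.+1; rewrite -?addSnnS //; lia.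
Qed.

(** The diagram W with its crossing (Some b, p) of slice h replaced by a jog, two
    strands being added on the right of W, joined at the bottom and at the top. The
    jog connects the under strand of the crossing with the first added strand, so
    that it runs to the top on the first, down the whole diagram on the second, and
    up again on the first. Since the second one is next to every line of W, it can
    receive the head of an arrow with its tail anywhere, here on strand i of
    line l. *)
Definition ladder W h b p (e : bool) (l i : nat) : wdiagram :=
  (Cup, 0) :: blocks W h b p 0 l ++ tail e i (width W l).+1
    ++ blocks W h b p l (size W - l) ++ [:: (Cap, 0)].

(** The common shape of the ladders with the tail just below and just above
    slice k. *)
Definition around W h b p k (A : wdiagram) : wdiagram :=
  (Cup, 0) :: blocks W h b p 0 k ++ A
    ++ blocks W h b p k.+1 (size W - k.+1) ++ [:: (Cap, 0)].

Lemma ladder_below W h b p e k i : k < size W ->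
  ladder W h b p e k i =
  around W h b p k (tail e i (width W k).+1 ++ block W h b p k).
Proof. by move=> kW; rewrite /ladder /around -subnSK // blocksS -!catA. Qed.

Lemma ladder_above W h b p e k i : k < size W ->
  ladder W h b p e k.+1 i =
  around W h b p k (block W h b p k ++ tail e i (width W k.+1).+1).
Proof.
move=> kW; rewrite /ladder /around -addn1 blocks_cat add0n.
by rewrite [blocks W h b p k 1]/blocks /= cats0 addn1 -!catA.
Qed.

Lemma around_eqv W h b p k A B :
  closed W -> onth W h = Some (crossing (Some b) p) -> k < size W ->
  wf A (width W k).+2 -> out A (width W k).+2 = (width W k.+1).+2 ->
  eqv (width W k).+2 A B -> eqv 0 (around W h b p k A) (around W h b p k B).
Proof.
rewrite /closed tangleE => /andP[wW /eqP oW] hW kW wA oA E; rewrite /around.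
have [w1 o1] : wf (blocks W h b p 0 k) 2 /\ out (blocks W h b p 0 k) 2 = (width W k).+2.
  have := @blocks_typ W h b p 0 k wW hW.
  by rewrite add0n (_ : width W 0 = 0) ?widthE ?take0 //; apply; lia.
have [w2 o2] : wf (blocks W h b p k.+1 (size W - k.+1)) (width W k.+1).+2 /\
    out (blocks W h b p k.+1 (size W - k.+1)) (width W k.+1).+2 = 2.
  have [|w o] := @blocks_typ W h b p k.+1 (size W - k.+1) wW hW; first lia.
  by split; rewrite // o subnKC // widthE take_size oW.
have wu : wf ((Cup, 0) :: blocks W h b p 0 k) 0 by rewrite wf_cup.
rewrite -{1}o1 -(out_cup 0) in E.
have := eqv_ctx (v := blocks W h b p k.+1 (size W - k.+1) ++ [:: (Cap, 0)]) wu E.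
rewrite !cat_cons; apply.
by rewrite !typE /= o1 oA w2 o2.
Qed.

(** The next slice is not one where the traveller passes under a classical
    crossing. *)
Definition travel_ok (W : wdiagram) (x : position) : bool :=
  let: (h, i, up) := x in
  if slice_ahead W x is Some (Cross (Some b), q) then
    (q <= i < q.+2) ==> (b == (i == if up then q else q.+1))
  else true.

(** The sign is counted along the direction of the travel, whereas that of [tail] is
    for strands read upwards. *)
Definition ladder_at W h b p e (x : position) : wdiagram :=
  let: (l, i, up) := x in ladder W h b p (e (+) up) l i.

Lemma pass_lt K (s : slice K) i j m : s.2 + legs_in s.1 <= m ->
  pass s i = (true, j) -> i < m -> j < strands_after m s.
Proof.
case: s => [[||k] q] /= fs; rewrite /strands_after /=; case: (ltnP i q) => ?;
  try case: (leqP (q + _) i) => ?; case=> //; lia.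
Qed.

Lemma pass_upside_down K (s : slice K) i j m : s.2 + legs_in s.1 <= m ->
  i < strands_after m s ->
  pass (upside_down s) i = (true, j) -> pass s j = (true, i) /\ j < m.
Proof.
case: s => [[||k] q]; rewrite /strands_after /= => fs im; case: (ltnP i q) => ?;
  try case: (leqP (q + _) i) => ?; case=> // jE; case: (ltnP j q) => ?;
  try case: (leqP (q + _) j) => ?;
  by split; try lia; congr pair; lia.
Qed.

Lemma pass_cross K (k : K) p i : pass (Cross k, p) i = (true, swap p i).
Proof.
rewrite /= /swap addn2; case: ltnP => // _; case: leqP => // h.
by rewrite subnK // (leq_trans _ h).
Qed.

(** At slice h the tail goes through the jog. A tail on the under strand would leave
    on the added strand instead of strand j; [overpass] excludes it. *)
Lemma block_through W h b p e k s i j :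
  wf W 0 -> onth W h = Some (crossing (Some b) p) -> onth W k = Some s ->
  pass s i = (true, j) -> overpass s i -> i < width W k ->
  eqv (width W k).+2 (tail e i (width W k).+1 ++ block W h b p k)
                     (block W h b p k ++ tail e j (width W k.+1).+1).
Proof.
move=> wW hW sE ps ov ik; have := onth_fits wW sE => fs.
rewrite (widthS sE) /block; case: eqP => [kh|_]; last first.
  rewrite sE /=; have -> : (strands_after (width W k) s).+1 =
     (width W k).+1 - legs_in s.1 + legs_out s.1 by rewrite /strands_after; lia.
  apply: tail_through => //; first exact: leqW.
  by rewrite ltnS (ltnW ik) ltnSn.
move: sE; rewrite kh hW => -[sE]; subst s k; rewrite /= in fs.
rewrite /strands_after /= subnK; last lia.
have -> : j = jog_pos b p (width W h) i.
  move: ps ov; rewrite pass_cross /overpass /jog_pos /swap /= => -[<-].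
  by case: (b) => /= /implyP ov; ifs.
by apply: tail_jog; lia.
Qed.

Lemma travel_up K (D : diagram K) h i s : onth D h = Some s ->
  travel D (h, i, true) =
  if (pass s i).1 then (h.+1, (pass s i).2, true) else (h, (pass s i).2, false).
Proof. by move=> /= ->; case: (pass s i). Qed.

Lemma travel_down K (D : diagram K) h i s : onth D h = Some s ->
  let t := pass (upside_down s) i in
  travel D (h.+1, i, false) = if t.1 then (h, t.2, false) else (h.+1, t.2, true).
Proof. by move=> sE; rewrite /travel /slice_ahead [h.+1.-1]/= sE; case: (pass _ i). Qed.

(** One step of the sliding of the tail: a tail going through a slice is
    [block_through]; at an extremum the traveller stays on the same line and turns
    round, and the sign of [tail] changes ([tail_turn_cup], [tail_turn_cap]). *)
Lemma ladder_travel W h b p e x : closed W -> onth W h = Some (crossing (Some b) p) ->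
  x.1.2 < width W x.1.1 -> travel_ok W x ->
  eqv 0 (ladder_at W h b p e x) (ladder_at W h b p e (travel W x)).
Proof.
move=> cW hW; have wW : wf W 0 by move: cW; rewrite /closed tangleE => /andP[].
case: x => -[l i] up il; rewrite -[_ < _]/(i < width W l) in il.
case: up.
  rewrite /travel_ok /slice_ahead.
  case sE: (onth W l) => [s|] ok; last by rewrite /travel /slice_ahead sE; exact: eqv_refl.
  have lW := onth_lt sE; have fs := onth_fits wW sE.
  rewrite (travel_up _ sE); case ps: (pass s i) => [[] j] /=.
    rewrite ladder_below // ladder_above //.
    have jl := pass_lt fs ps il; rewrite -(widthS sE) in jl.
    have [wb ob] := block_typ wW hW lW.
    apply: around_eqv => //.
    - by rewrite wf_cat tail_wf ?tail_out //; lia.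
    - by rewrite out_cat tail_out //; lia.
    - apply: (block_through _ wW hW sE ps) => //.
      by move: ok; rewrite /overpass; case: (s) => [[||[?|]] q].
  have [q sq [iq jq]] : exists2 q, s = (Cap, q) & q <= i < q.+2 /\ j = q + q.+1 - i.
    move: ps; case: (s) => [[||k] q] /=; case: (ltnP i q) => ? //;
    case: (leqP (q + _) i) => ? // -[<-]; exists q => //; lia.
  subst s; rewrite /= in fs; have lh : (l == h) = false by apply/eqP => lh; move: sE; rewrite lh hW.
  have bE : block W h b p l = [:: (Cap, q)] by rewrite /block lh sE.
  rewrite !ladder_below // bE addbT addbF.
  have wS := widthS sE; rewrite /strands_after /= in wS.
  apply: around_eqv => //.
  - by rewrite wf_cat tail_wf ?tail_out ?wf_cap ?wf_nil /=; lia.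
  - by rewrite out_cat tail_out ?out_cap ?out_nil /=; lia.
  have [iE|iE] : i = q \/ i = q.+1 by lia.
  - have -> : j = q.+1 by lia.
    by rewrite iE -{2}[e]negbK; apply: tail_turn_cap; lia.
  - have -> : j = q by lia.
    by rewrite iE; apply: eqv_sym; apply: tail_turn_cap; lia.
case: l il => [|k]; first by rewrite widthE take0.
rewrite /travel_ok /slice_ahead [k.+1.-1]/= => il; case sE: (onth W k) => [s|] ok; last first.
  by rewrite /travel /slice_ahead [k.+1.-1]/= sE; exact: eqv_refl.
have kW := onth_lt sE; have fs := onth_fits wW sE.
have wS := widthS sE; rewrite wS in il.
rewrite (travel_down _ sE); case ps: (pass (upside_down s) i) => [[] j] /=.
  have [{}ps jk] := pass_upside_down fs il ps.
  rewrite ladder_above // ladder_below //; apply: eqv_sym.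
  have [wb ob] := block_typ wW hW kW.
  rewrite -wS in il; apply: around_eqv => //.
  - by rewrite wf_cat tail_wf ?tail_out //; lia.
  - by rewrite out_cat tail_out //; lia.
  - apply: (block_through _ wW hW sE ps) => //.
    move: ok ps fs; rewrite /overpass; case: (s) => [[||[c|]] q] // ok.
    rewrite pass_cross /swap => -[iE] /= fs; move: ok => /=; rewrite -iE.
    by case: (c) => /=; ifs.
have [q sq [iq jq]] : exists2 q, s = (Cup, q) & q <= i < q.+2 /\ j = q + q.+1 - i.
  move: ps; case: (s) => [[||k'] q] /=; case: (ltnP i q) => ? //;
  case: (leqP (q + _) i) => ? // -[<-]; exists q => //; lia.
subst s; rewrite /= in fs; have lh : (k == h) = false by apply/eqP => kh; move: sE; rewrite kh hW.
have bE : block W h b p k = [:: (Cup, q)] by rewrite /block lh sE.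
rewrite !ladder_above // bE addbT addbF.
rewrite /strands_after /= in wS il.
apply: around_eqv => //.
- by rewrite wS; tys.
- by rewrite wS; tys.
have [iE|iE] : i = q \/ i = q.+1 by lia.
- have -> : j = q.+1 by lia.
  by rewrite iE; apply: tail_turn_cup; lia.
- have -> : j = q by lia.
  by rewrite iE -{1}[e]negbK; apply: eqv_sym; apply: tail_turn_cup; lia.
Qed.

Definition on_strand K (D : diagram K) (x : position) : bool :=
  x.1.2 < width D x.1.1.

Lemma pass_turn K (s : slice K) i j : pass s i = (false, j) ->
  exists2 q, s = (Cap, q) & q <= i < q.+2 /\ j = q + q.+1 - i.
Proof.
case: s => [[||k] q] /=; case: (ltnP i q) => ? //;
  case: (leqP (q + _) i) => ? // -[<-]; exists q => //; lia.
Qed.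

Lemma pass_upside_down_turn K (s : slice K) i j :
  pass (upside_down s) i = (false, j) ->
  exists2 q, s = (Cup, q) & q <= i < q.+2 /\ j = q + q.+1 - i.
Proof.
move=> /pass_turn[q sq ij]; exists q => //.
by move: sq; case: s => [[||k] q'] //= [->].
Qed.

Lemma travel_on_strand K (D : diagram K) x :
  wf D 0 -> on_strand D x -> on_strand D (travel D x).
Proof.
move=> wD; case: x => -[l i] up; rewrite /on_strand [_.1.2]/= [_.1.1]/= => il.
case: up; last first.
  case: l il => [|k il]; first by rewrite widthE take0.
  case sE: (onth D k) => [s|]; last by rewrite /travel /slice_ahead [k.+1.-1]/= sE.
  rewrite (travel_down _ sE); have fs := onth_fits wD sE.
  case ps: (pass _ i) => [[] j] /=.
    by rewrite (widthS sE) in il; have [] := pass_upside_down fs il ps.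
  have [q sq [iq ->]] := pass_upside_down_turn ps.
  move: il; rewrite (widthS sE) sq /strands_after /= => il.
  by move: fs; rewrite sq /=; lia.
case sE: (onth D l) => [s|]; last by rewrite /travel /slice_ahead sE.
rewrite (travel_up _ sE); have fs := onth_fits wD sE.
case ps: (pass s i) => [[] j] /=.
  by rewrite (widthS sE); apply: pass_lt fs ps il.
have [q sq [iq ->]] := pass_turn ps.
by move: fs; rewrite sq /=; lia.
Qed.

Lemma iter_on_strand K (D : diagram K) x k :
  wf D 0 -> on_strand D x -> on_strand D (iter k (travel D) x).
Proof. by move=> wD xD; elim: k => //= k; apply: travel_on_strand. Qed.

Lemma ladder_path W h b p e x k : closed W -> onth W h = Some (crossing (Some b) p) ->
  on_strand W x -> (forall j, j < k -> travel_ok W (iter j (travel W) x)) ->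
  eqv 0 (ladder_at W h b p e x) (ladder_at W h b p e (iter k (travel W) x)).
Proof.
move=> cW hW xW; have wW : wf W 0 by move: cW; rewrite /closed tangleE => /andP[].
elim: k => [|k IH] ok; first exact: eqv_refl.
apply: eqv_trans (IH _) _ => [j jk|]; first by apply: ok; exact: leqW.
by rewrite iterS; apply: ladder_travel => //; [exact: iter_on_strand|exact: ok].
Qed.

Lemma blocks_id W h b p k l : k + l <= h \/ h < k -> k + l <= size W ->
  blocks W h b p k l = take l (drop k W).
Proof.
elim: l k => [|l IH] k hk kl; first by rewrite take0.
have kW : k < size W by lia.
case sE: (onth W k) (onthTE W k) => [s|]; rewrite kW // => _.
rewrite blocksS IH; [|lia..].
rewrite (drop_nth s kW) /= -(odflt_onth s) sE /= /block sE.
by case: eqP => [kh|//]; lia.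
Qed.

(** The added strands can be retracted to slice h when the tail is there: their
    cup slides up through [u], and their cap slides down through [v]. *)
Lemma around_core u v b p A k : closed (u ++ crossing (Some b) p :: v) ->
  let W := u ++ crossing (Some b) p :: v in
  let n := out u 0 in
  wf A n.+2 -> out A n.+2 = n.+2 ->
  eqv n ((Cup, n) :: A ++ [:: (Cap, n)]) [:: crossing k p] ->
  eqv 0 (around W (size u) b p (size u) A) (u ++ crossing k p :: v).
Proof.
move=> cW W n wA oA E; move: cW.
rewrite /closed tangleE wf_cat out_cat -/n => /andP[/andP[wu wv] /eqP ov].
have pn : p.+2 <= n by move: wv; rewrite wf_cons /= addn2 => /andP[].
have n2 : 2 <= n by lia.
move: wv ov; rewrite wf_cross // out_cross // -/n => /andP[_ wv] ov.
have sW : size W = size u + (size v).+1 by rewrite size_cat.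
rewrite /around sW !blocks_id ?sW; [|lia..].
rewrite drop0 take_size_cat // addnS subSS addKn.
rewrite /W -cat_rcons drop_size_cat ?size_rcons // take_size.
have [wu2 ou2] := widen wu (leq0n 2); rewrite addn0 -/n in ou2.
have [wv2 ov2] : wf v n.+2 /\ out v n.+2 = 2.
  by have [w o] := widen wv (leqW (leqnSn n)); split=> //; lia.
apply: (@eqv_trans _ _ ((u ++ [:: (Cup, n)]) ++ A ++ v ++ [:: (Cap, 0)])).
  rewrite -cat_cons; apply: eqv_catr.
    by rewrite out_cup !wf_cat ou2 addn2 wA oA wv2 ov2.
  by apply/eqv_sym/(@word_commute _ _ _ _ 0); rewrite // -/n ?addn0 ?add0n.
apply: (@eqv_trans _ _ (u ++ ((Cup, n) :: A ++ [:: (Cap, n)]) ++ v)).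
  rewrite -catA; apply: eqv_catl => //=.
  rewrite -cat_cons -[R in eqv _ _ (_ :: R)]catA -cat_cons; apply: eqv_catl.
    by rewrite wf_cup leqnn wA.
  rewrite out_cup -/n oA; by apply: (@word_commute _ _ _ _ n); rewrite //= ?ov ?addn0 ?addn2.
apply: (@eqv_ctx 0 u v _ [:: crossing k p]) => //.
by rewrite out_cat -/n out_cup out_cat oA out_cap out_nil.
Qed.

(** The two possible values of [x] are the ways to leave the crossing on its over
    strand, and the two possible ends of the travel are the ways to enter it on its
    under strand. With the tail at [x] the ladder is the given diagram, by
    [jog_tail_cross]; the tail slides along the travel by [ladder_path]; at the end
    the arrow disappears, by [jog_tail_above] or [jog_tail_below]. *)
Lemma weld_crossing u v b p x k : closed (u ++ crossing (Some b) p :: v) ->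
  let W := u ++ crossing (Some b) p :: v in
  x \in [:: ((size u).+1, if b then p.+1 else p, true);
            (size u, if b then p else p.+1, false)] ->
  (forall j, j < k -> travel_ok W (iter j (travel W) x)) ->
  iter k (travel W) x \in [:: ((size u).+1, if b then p else p.+1, false);
                              (size u, if b then p.+1 else p, true)] ->
  eqv 0 W (u ++ welded p :: v).
Proof.
move=> cW W xP ok yP; move: (cW).
rewrite /closed tangleE wf_cat out_cat => /andP[/andP[wu wv] /eqP ov].
set n := out u 0 in wv ov.
have pn : p.+2 <= n by move: wv; rewrite wf_cons /= addn2 => /andP[].
have hW : onth W (size u) = Some (crossing (Some b) p) by rewrite /W onth_cat ltnn subnn.
have uW : size u < size W by rewrite size_cat /=; lia.
have nE : width W (size u) = n by rewrite widthE take_size_cat.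
have nE' : width W (size u).+1 = n by rewrite (widthS hW) nE /strands_after /= subnK //; lia.
have bE : block W (size u) b p (size u) = jog b p n by rewrite /block eqxx nE.
have io : (if b then p.+1 else p) < n by case: (b); lia.
have ii : (if b then p else p.+1) < n by case: (b); lia.
pose e := if x.2 then b else ~~ b.
apply: (@eqv_trans _ _ (ladder_at W (size u) b p e x)).
  apply: eqv_sym; move: xP; rewrite !inE => /orP[]/eqP xE; rewrite /e xE /=.
    rewrite ladder_above // bE nE'; apply: around_core => //.
    - by rewrite wf_cat jog_wf ?jog_out ?tail_wf // -/n; lia.
    - by rewrite out_cat jog_out ?tail_out // -/n; lia.
    by rewrite -catA addbT; apply: jog_tail_cross; rewrite -/n; lia.
  apply: eqv_trans (_ : eqv 0 _ (around W (size u) b p (size u) (jog b p n ++ tail (~~ b) (if b then p.+1 else p) n.+1))) _.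
    rewrite ladder_below // bE nE addbF; apply: around_eqv => //.
    - by rewrite nE wf_cat tail_wf ?tail_out ?jog_wf //; lia.
    - by rewrite nE nE' out_cat tail_out ?jog_out //; lia.
    rewrite nE; have <- : jog_pos b p n (if b then p else p.+1) = (if b then p.+1 else p).
      by rewrite /jog_pos; case: (b); ifs.
    by apply: tail_jog; lia.
  apply: around_core => //.
  - by rewrite wf_cat jog_wf ?jog_out ?tail_wf // -/n; lia.
  - by rewrite out_cat jog_out ?tail_out // -/n; lia.
  by rewrite -catA; apply: jog_tail_cross; rewrite -/n; lia.
have xW : on_strand W x.
  by move: xP; rewrite !inE => /orP[]/eqP->; rewrite /on_strand /= ?nE ?nE'.
apply: eqv_trans (ladder_path e cW hW xW ok) _.
move: yP; rewrite !inE => /orP[]/eqP->; rewrite /ladder_at.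
  rewrite ladder_above // bE nE'; apply: around_core => //.
  - by rewrite wf_cat jog_wf ?jog_out ?tail_wf // -/n; lia.
  - by rewrite out_cat jog_out ?tail_out // -/n; lia.
  by rewrite -catA; apply: jog_tail_above; rewrite -/n; lia.
rewrite ladder_below // bE nE; apply: around_core => //.
- by rewrite wf_cat tail_wf ?tail_out ?jog_wf // -/n; lia.
- by rewrite out_cat tail_out ?jog_out // -/n; lia.
by rewrite -catA; apply: jog_tail_below; rewrite -/n; lia.
Qed.

(** * Welded diagrams without classical crossings *)

(** A cap of the strands a and a + d + 1, welded to those between them. *)
Fixpoint bridge (a d : nat) : wdiagram :=
  if d is d'.+1 then welded (a + d) :: bridge a d' else [:: (Cap, a)].

Definition is_v (s : slice (option bool)) : bool := if s.1 is Cross None then true else false.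
Definition is_cup K (s : slice K) : bool := if s.1 is Cup then true else false.
Definition cup_or_v (s : slice (option bool)) : bool := is_cup s || is_v s.

Lemma all_is_v w : all is_v w -> all cup_or_v w.
Proof. by apply: sub_all => s; rewrite /cup_or_v => ->; rewrite orbT. Qed.

Lemma count_is_v w : all is_v w -> count (@is_cup _) w = 0.
Proof. by elim: w => //= -[[||[]] q] w IH. Qed.

Lemma bridge_typ a d m : a + d.+2 <= m ->
  wf (bridge a d) m /\ out (bridge a d) m = m.-2.
Proof.
elim: d m => [|d IH] m h /=; first by split; typ.
by rewrite wf_cross ?out_cross; [|lia..]; have [|-> ->] := IH m; lia.
Qed.

Lemma bridge_wf a d m : a + d.+2 <= m -> wf (bridge a d) m.
Proof. by move/bridge_typ=> []. Qed.

Lemma bridge_out a d m : a + d.+2 <= m -> out (bridge a d) m = m.-2.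
Proof. by move/bridge_typ=> []. Qed.

Lemma bridge_commute f a d q m : a + d.+2 <= q -> q + legs_in f <= m ->
  eqv m ((f, q) :: bridge a d) (bridge a d ++ [:: (f, q.-2)]).
Proof.
move=> h hm; apply/eqv_sym/(@word_commute _ _ _ _ (a + d.+2)) => //.
- exact: bridge_wf.
- by rewrite bridge_out //; lia.
Qed.

Lemma cons_eqv m s A B : s.2 + legs_in s.1 <= m ->
  eqv (m - legs_in s.1 + legs_out s.1) A B -> eqv m (s :: A) (s :: B).
Proof. by move=> h E; apply: (@eqv_catl m [:: s]) => //; rewrite wf_cons h wf_nil. Qed.

Lemma v_cons_eqv m q A B : q.+2 <= m -> eqv m A B -> eqv m (welded q :: A) (welded q :: B).
Proof. by move=> h E; apply: cons_eqv => /=; [lia|rewrite subnK //; lia]. Qed.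

Lemma rewrite_head m A B R Z : eqv m A B -> wf R (out A m) ->
  eqv m (B ++ R) Z -> eqv m (A ++ R) Z.
Proof. by move=> E w; apply: eqv_trans; apply: eqv_catr. Qed.

(** A welded crossing below a bridge is absorbed, or passes above it; as it does not
    involve the right leg of the bridge, this leg stays in place. *)
Lemma v_bridge_inside q a d m : q < a + d -> a + d.+2 <= m ->
  exists a' d' w, [/\ a' + d' = a + d, all is_v w &
    eqv m (welded q :: bridge a d) (bridge a' d' ++ w)].
Proof.
elim: d q => [|d IH] q.
  rewrite addn0 => qa am; case: (ltnP q a.-1) => qa'.
    exists a, 0, [:: welded q]; split; rewrite ?addn0 //=.
    by rw 0 (@far_commute (Cross None) Cap q a a); exact: eqv_refl.
  have aE : a = q.+1 by lia.
  subst a; exists q, 1, [::]; split => //; first by rewrite addn1.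
  by rewrite /= addn1; rw 0 (@slide_capl None q); exact: eqv_refl.
rewrite addnS => qad am; case: (ltnP q (a + d)) => qd.
  have [|a' [d' [w [e1 vw E]]]] := IH q qd; first lia.
  exists a', d'.+1, w; split; rewrite // ?addnS ?e1 //=.
  rewrite !addnS e1; apply: (@rewrite_head _ [:: welded q; welded (a + d).+1] [:: welded (a + d).+1; welded q] (bridge a d)).
  - by apply: far_commute => /=; lia.
  - by rewrite !out_cross ?out_nil; [|lia..]; apply: bridge_wf; lia.
  by apply: v_cons_eqv => //; lia.
have {qd qad} -> : q = a + d by lia.
case: d {IH} am => [|d] am.
  exists a.+1, 0, [::]; split=> //.
  rewrite /= ?addn1 ?addn0.
  by rw 0 (@cap_under_v a); exact: eqv_refl.
exists a, d.+2, [:: welded (a + d)]; split=> //; first lia.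
rewrite /= !addnS; apply: (@rewrite_head _ [:: welded (a + d).+1; welded (a + d).+2; welded (a + d).+1]
  [:: welded (a + d).+2; welded (a + d).+1; welded (a + d).+2] (bridge a d)).
- by apply: vxv; lia.
- by rewrite !out_cross ?out_nil; [|lia..]; apply: bridge_wf; lia.
rewrite /=; do 2 (apply: v_cons_eqv; first lia).
by have := @bridge_commute (Cross None) a d (a + d).+2 m; apply; rewrite /=; lia.
Qed.

Lemma v_bridge q a d m : q.+2 <= m -> a + d.+2 <= m ->
  exists a' d' w, [/\ a' + d'.+2 <= m, all is_v w &
    eqv m (welded q :: bridge a d) (bridge a' d' ++ w)].
Proof.
move=> qm am; case: (ltnP q (a + d)) => qd.
  have [a' [d' [w [e1 vw E]]]] := v_bridge_inside qd am.
  by exists a', d', w; split=> //; lia.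
case: (ltnP q (a + d.+2)) => qb; last first.
  exists a, d, [:: welded q.-2]; split=> //.
  by apply: bridge_commute => //=; lia.
have [qE|qE] : q = a + d \/ q = a + d.+1 by lia.
  case: d qE {qd qb} am => [|d] qE am.
    rewrite addn0 in qE; exists a, 0, [::]; split=> //=.
    by rewrite qE; rw 0 (@r1_cap None a); exact: eqv_refl.
  exists a, d, [::]; split=> //; [lia|].
  rewrite qE cats0 /=; apply: (@rewrite_head _ [:: _; _] [::] (bridge a d)).
  - by apply: r2v; lia.
  - by rewrite !out_cross ?out_nil; [|lia..]; apply: bridge_wf; lia.
  exact: eqv_refl.
exists a, d.+1, [::]; split=> //; first lia.
by rewrite cats0 qE; exact: eqv_refl.
Qed.

(** A cup one leg of which is bridged to another strand pulls straight. *)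
Lemma zigzag_bridge a d m : a + d.+1 <= m ->
  exists2 w, all is_v w & eqv m ((Cup, a + d.+1) :: bridge a d) w.
Proof.
elim: d m => [|d IH] m h.
  exists [::] => //; rewrite addn1 /=.
  by rw 0 (@zigzag_left a); exact: eqv_refl.
have [|w vw E] := IH m; first lia.
exists (w ++ [:: welded (a + d)]); first by rewrite all_cat vw.
rewrite !addnS /=; apply: (@rewrite_head _ [:: (Cup, (a + d).+2); _] [:: (Cup, (a + d).+1); welded (a + d).+2] (bridge a d)).
- by rewrite addnS; apply: slide_cupl; lia.
- by rewrite out_cup out_cross ?out_nil; [|lia]; apply: bridge_wf; lia.
apply: eqv_trans (_ : eqv m _ (((Cup, (a + d).+1) :: bridge a d) ++ [:: welded (a + d)])) _.
  apply: cons_eqv => /=; first lia.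
  by have := @bridge_commute (Cross None) a d (a + d).+2 (m - 0 + 2); apply; rewrite /=; lia.
apply: eqv_catr; last by rewrite addnS in E.
by rewrite out_cup bridge_out; [rewrite wf_cross ?wf_nil; lia|lia].
Qed.

(** Sliding a bridge below a cup: it passes the cup, or straightens it, or closes
    off a circle. *)
Variant bridge_below_cup (m q a d : nat) : Prop :=
| Bridge_passes a' d' w of a' + d'.+2 <= m & all cup_or_v w & count (@is_cup _) w <= 1
    & eqv m ((Cup, q) :: bridge a d) (bridge a' d' ++ w)
| Bridge_straightens w of all is_v w & eqv m ((Cup, q) :: bridge a d) w
| Bridge_closes q' w w' of all is_v w & all is_v w'
    & eqv m ((Cup, q) :: bridge a d) (w ++ [:: (Cup, q'); (Cap, q')] ++ w').

Lemma cup_bridge q a d m : q <= m -> a + d <= m -> bridge_below_cup m q a d.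
Proof.
elim: d q m => [|d IH] q m qm am.
  rewrite addn0 in am.
  have [h|h] := ltnP q.+1 a.
    apply: (@Bridge_passes _ _ _ _ a.-2 0 [:: (Cup, q)]) => //=; first lia.
    by rw 0 (@far_commute Cup Cap q a a.-2); exact: eqv_refl.
  have [h'|h'] := ltnP q a.
    apply: (@Bridge_straightens _ _ _ _ [::]) => //=.
    have -> : a = q.+1 by lia.
    by rw 0 (@zigzag_right q); exact: eqv_refl.
  have [<-|h''] := eqVneq a q.
    by apply: (@Bridge_closes _ _ _ _ a [::] [::]) => //=; exact: eqv_refl.
  have [h3|h3] := ltnP q a.+2.
    have [|w vw E] := @zigzag_bridge a 0 m; first lia.
    apply: (@Bridge_straightens _ _ _ _ w) => //.
    by have -> : q = a + 1 by lia.
  apply: (@Bridge_passes _ _ _ _ a 0 [:: (Cup, q.-2)]) => //=; first lia.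
  by apply: (@bridge_commute _ a 0); rewrite /=; lia.
have wb k : a + d.+2 <= k -> wf (bridge a d) k by exact: bridge_wf.
have [h|h] := ltnP q.+1 (a + d.+1).
  have E0 : eqv m ((Cup, q) :: bridge a d.+1) (welded (a + d.+1).-2 :: (Cup, q) :: bridge a d).
    apply: (@rewrite_head _ [:: _; _] [:: welded (a + d.+1).-2; (Cup, q)] (bridge a d)).
    - by apply: far_commute => /=; lia.
    - by rewrite out_cup out_cross ?out_nil; [|lia]; apply: wb; lia.
    exact: eqv_refl.
  have hm : (a + d.+1).-2.+2 <= m by lia.
  have [||a' d' w h1 h2 h3 E|w h2 E|q' w w' h1 h2 E] := IH q m; [lia|lia|..].
  - have [a2 [d2 [w2 [g1 g2 E2]]]] := v_bridge hm h1.
    apply: (@Bridge_passes _ _ _ _ a2 d2 (w2 ++ w)) => //.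
    + by rewrite all_cat h2 all_is_v.
    + by rewrite count_cat count_is_v.
    apply: eqv_trans E0 _; apply: eqv_trans (v_cons_eqv hm E) _.
    rewrite -cat_cons; apply: rewrite_head E2 _ _; last by rewrite -catA; exact: eqv_refl.
    have w0 : wf (welded (a + d.+1).-2 :: (Cup, q) :: bridge a d) m.
      by rewrite wf_cross ?wf_cup ?wb; lia.
    have := eqv_wf (v_cons_eqv hm E) w0.
    by rewrite -cat_cons wf_cat => /andP[].
  - apply: (@Bridge_straightens _ _ _ _ (welded (a + d.+1).-2 :: w)) => //.
    exact: eqv_trans E0 (v_cons_eqv hm E).
  - apply: (@Bridge_closes _ _ _ _ q' (welded (a + d.+1).-2 :: w) w') => //.
    exact: eqv_trans E0 (v_cons_eqv hm E).
have [qE|h2] := eqVneq q (a + d).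
  have E0 : eqv m ((Cup, q) :: bridge a d.+1) ((Cup, q.+1) :: welded q :: bridge a d).
    rewrite /= addnS -qE; apply: (@rewrite_head _ [:: _; _] [:: (Cup, q.+1); welded q] (bridge a d)).
    - by apply: slide_cup; lia.
    - by rewrite out_cup out_cross ?out_nil; [|lia]; apply: wb; lia.
    exact: eqv_refl.
  case: d {IH wb h} am qE E0 => [|d] am qE E0.
    apply: (@Bridge_straightens _ _ _ _ [::]) => //=; apply: eqv_trans E0 _.
    rewrite addn0 in qE; subst q; rewrite /=.
    by rw 1 (@r1_cap None a); rw 0 (@zigzag_left a); exact: eqv_refl.
  apply: (@Bridge_passes _ _ _ _ a d [:: (Cup, q.+1.-2)]) => //=.
  apply: eqv_trans E0 _.
  apply: eqv_trans (_ : eqv m _ ((Cup, q.+1) :: bridge a d)) _; last first.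
    by apply: bridge_commute => /=; lia.
  apply: cons_eqv => /=; first lia.
  rewrite -qE; apply: (@rewrite_head _ [:: welded q; welded q] [::] (bridge a d)).
  - by apply: r2v; lia.
  - by rewrite !out_cross ?out_nil; [|lia..]; apply: bridge_wf; lia.
  exact: eqv_refl.
have [qE|h3] := eqVneq q (a + d.+1).
  have [|w vw E] := @zigzag_bridge a d m; first lia.
  apply: (@Bridge_straightens _ _ _ _ w) => //.
  apply: eqv_trans E; rewrite /= -qE; apply: (@rewrite_head _ [:: _; _] [:: (Cup, q)] (bridge a d)).
  - by apply: r1_cup.
  - by rewrite out_cup out_cross ?out_nil; [|lia]; apply: wb; lia.
  exact: eqv_refl.
have [qE|h4] := eqVneq q (a + d.+2).
  have [|w vw E] := @zigzag_bridge a d.+1 m; first lia.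
  by apply: (@Bridge_straightens _ _ _ _ w); rewrite // qE.
apply: (@Bridge_passes _ _ _ _ a d.+1 [:: (Cup, q.-2)]) => //; first lia.
by apply: bridge_commute => /=; lia.
Qed.

(** Sliding a bridge down a word without caps: since the word starts with no strand
    at all, the bridge cannot reach its bottom, and must straighten or close off
    some cup on its way. *)
Lemma bridge_slide C a d : all cup_or_v C -> wf C 0 -> a + d.+2 <= out C 0 ->
  (exists C', [/\ all cup_or_v C', count (@is_cup _) C' < count (@is_cup _) C &
     eqv 0 (C ++ bridge a d) C']) \/
  (exists C1 q C2, [/\ all cup_or_v C1, all cup_or_v C2 &
     eqv 0 (C ++ bridge a d) (C1 ++ [:: (Cup, q); (Cap, q)] ++ C2)]).
Proof.
elim/last_ind: C a d => [|C s IH] a d; first by rewrite out_nil => _ _; lia.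
rewrite -cats1 all_cat wf_cat out_cat => /andP[vC]; rewrite all_seq1 => vs /andP[wC ws] am.
set m := out C 0 in ws am.
have wCA A B : eqv m A B -> eqv 0 (C ++ A) (C ++ B) by exact: eqv_catl.
have wb : wf (s :: bridge a d) m.
  move: ws am; rewrite !wf_cons wf_nil andbT out_cons out_nil => -> /=.
  exact: bridge_wf.
have step a' d' w : a' + d'.+2 <= m -> all cup_or_v w ->
    count (@is_cup _) w <= count (@is_cup _) [:: s] ->
    eqv m (s :: bridge a d) (bridge a' d' ++ w) ->
  (exists C', [/\ all cup_or_v C', count (@is_cup _) C' < count (@is_cup _) (C ++ [:: s]) &
     eqv 0 ((C ++ [:: s]) ++ bridge a d) C']) \/
  (exists C1 q C2, [/\ all cup_or_v C1, all cup_or_v C2 &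
     eqv 0 ((C ++ [:: s]) ++ bridge a d) (C1 ++ [:: (Cup, q); (Cap, q)] ++ C2)]).
  move=> h1 h2 h3 E; rewrite count_cat -catA /=.
  have := eqv_wf E wb; rewrite wf_cat bridge_out // => /andP[_ ww].
  have {}E : eqv 0 (C ++ s :: bridge a d) ((C ++ bridge a' d') ++ w).
    by rewrite -catA; exact: wCA.
  have wv : wf w (out (C ++ bridge a' d') 0) by rewrite out_cat bridge_out.
  case: (IH a' d' vC wC h1) => [[C' [g1 g2 g3]]|[C1 [q [C2 [g1 g2 g3]]]]].
    left; exists (C' ++ w); split; first by rewrite all_cat g1.
      by rewrite count_cat; move: h3 g2 => /=; move: (nat_of_bool _) => n; lia.
    by apply: eqv_trans E _; apply: eqv_catr.
  right; exists C1, q, (C2 ++ w); split; rewrite ?all_cat ?g2 //.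
  apply: eqv_trans E _; apply: eqv_trans (eqv_catr wv g3) _.
  by rewrite -!catA; exact: eqv_refl.
case: s vs ws am wb step => [[||[b|]] q] // _ ws am wb step.
  have [||a' d' w h1 h2 h3 E|w h2 E|q' w w' h1 h2 E] := @cup_bridge q a d m.
  - by move: ws; rewrite wf_cup => /andP[].
  - by move: am; rewrite out_cup out_nil; lia.
  - exact: step E.
  - left; exists (C ++ w); split; first by rewrite all_cat vC all_is_v.
      by rewrite !count_cat (count_is_v h2) /=; lia.
    by rewrite -catA; exact: wCA.
  - right; exists (C ++ w), q', w'; split; rewrite ?all_cat ?vC ?all_is_v //.
    by rewrite -!catA; exact: wCA.
have qm : q.+2 <= m.
  by move: ws; rewrite wf_cons /= addn2 => /andP[].
have am' : a + d.+2 <= m by move: am; rewrite out_cross ?out_nil; lia.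
have [a' [d' [w [h1 h2 E]]]] := v_bridge qm am'.
by apply: step E; rewrite ?all_is_v ?count_is_v.
Qed.

(** * Counting colourings *)

Definition colors_out K (e : shape K) (c : seq bool) : seq (seq bool) :=
  match e with
  | Cup => [:: [:: true; true]; [:: false; false]]
  | Cap => if nth true c 0 == nth true c 1 then [:: [::]] else [::]
  | Cross _ => [:: [:: nth true c 1; nth true c 0]]
  end.

(** The colours of the strands on the top line of a slice, given those on its
    bottom line, when each arc has one colour. *)
Definition colors_above K (s : slice K) (c : seq bool) : seq (seq bool) :=
  [seq take s.2 c ++ x ++ drop (s.2 + legs_in s.1) c
     | x <- colors_out s.1 (take (legs_in s.1) (drop s.2 c))].

(** The number of colourings by two colours which extend given colours of the
    bottom strands. *)
Fixpoint colorings K (D : diagram K) (c : seq bool) : nat :=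
  if D is s :: D' then \sum_(c' <- colors_above s c) colorings D' c' else 1.

Arguments colorings : simpl never.

Lemma coloringsE K s (D : diagram K) c :
  colorings (s :: D) c = \sum_(c' <- colors_above s c) colorings D c'.
Proof. by []. Qed.

Lemma colors_aboveE K (e : shape K) p s x t :
  size s = p -> size x = legs_in e ->
  colors_above (e, p) (s ++ x ++ t) = [seq s ++ y ++ t | y <- colors_out e x].
Proof.
move=> sp xe; rewrite /colors_above; cbn [fst snd].
have -> : take p (s ++ x ++ t) = s by rewrite take_size_cat.
have -> : drop p (s ++ x ++ t) = x ++ t by rewrite drop_size_cat.
by rewrite take_size_cat // catA drop_size_cat // size_cat sp xe.
Qed.

Lemma size_colors_out K (e : shape K) x y :
  y \in colors_out e x -> size y = legs_out e.
Proof.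
case: e => [||k] /=; first by rewrite !inE => /orP[]/eqP->.
  by case: ifP => //; rewrite inE => _ /eqP->.
by rewrite inE => /eqP->.
Qed.

Lemma size_colors_above K (s : slice K) c c' : s.2 + legs_in s.1 <= size c ->
  c' \in colors_above s c -> size c' = strands_after (size c) s.
Proof.
move=> sc /mapP[y yE ->]; rewrite !size_cat (size_colors_out yE) size_takel ?size_drop.
  by move: sc; rewrite /strands_after; move: (size c) (legs_in _) (legs_out _) s.2 => *; lia.
by apply: leq_trans sc; exact: leq_addr.
Qed.

Lemma split_colors (c : seq bool) p n : p + n <= size c ->
  exists s x t, [/\ c = s ++ x ++ t, size s = p & size x = n].
Proof.
move=> h; exists (take p c), (take n (drop p c)), (drop n (drop p c)).
by split; rewrite ?cat_take_drop // size_takel ?size_drop //; lia.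
Qed.

Lemma colorings_cons K (e : shape K) p D s x t :
  size s = p -> size x = legs_in e ->
  colorings ((e, p) :: D) (s ++ x ++ t) =
  \sum_(y <- colors_out e x) colorings D (s ++ y ++ t).
Proof. by move=> sp xe; rewrite coloringsE colors_aboveE // big_map. Qed.

Lemma colorings_cup K p (D : diagram K) s t : size s = p ->
  colorings ((Cup, p) :: D) (s ++ t) =
  colorings D (s ++ true :: true :: t) + colorings D (s ++ false :: false :: t).
Proof.
by move=> sp; rewrite (@colorings_cons _ Cup _ _ s [::]) //= !big_cons big_nil addn0.
Qed.

Lemma colorings_cap K p (D : diagram K) s a b t : size s = p ->
  colorings ((Cap, p) :: D) (s ++ a :: b :: t) =
  if a == b then colorings D (s ++ t) else 0.
Proof.
move=> sp; rewrite (@colorings_cons _ Cap _ _ s [:: a; b]) //=.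
by case: ifP; rewrite ?big_cons big_nil ?addn0.
Qed.

Lemma colorings_cross K k p (D : diagram K) s a b t : size s = p ->
  colorings ((Cross k, p) :: D) (s ++ a :: b :: t) = colorings D (s ++ b :: a :: t).
Proof.
move=> sp; rewrite (@colorings_cons _ (Cross k) _ _ s [:: a; b]) //=.
by rewrite !big_cons big_nil addn0.
Qed.

Lemma colorings_cup1 K p (D : diagram K) s a t : size s = p ->
  colorings ((Cup, p.+1) :: D) (s ++ a :: t) =
  colorings D (s ++ a :: true :: true :: t) + colorings D (s ++ a :: false :: false :: t).
Proof.
by move=> sp; rewrite -cat_rcons colorings_cup ?size_rcons ?sp // !cat_rcons.
Qed.

Lemma colorings_cap1 K p (D : diagram K) s a b c t : size s = p ->
  colorings ((Cap, p.+1) :: D) (s ++ a :: b :: c :: t) =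
  if b == c then colorings D (s ++ a :: t) else 0.
Proof.
by move=> sp; rewrite -cat_rcons colorings_cap ?size_rcons ?sp // !cat_rcons.
Qed.

Lemma colorings_cross1 K k p (D : diagram K) s a b c t : size s = p ->
  colorings ((Cross k, p.+1) :: D) (s ++ a :: b :: c :: t) =
  colorings D (s ++ a :: c :: b :: t).
Proof.
by move=> sp; rewrite -cat_rcons colorings_cross ?size_rcons ?sp // !cat_rcons.
Qed.

Lemma colorings_interchange K (e f : shape K) p r D c :
  p + legs_in e + r + legs_in f <= size c ->
  colorings [:: (e, p), (f, p + legs_out e + r) & D] c =
  colorings [:: (f, p + legs_in e + r), (e, p) & D] c.
Proof.
move=> h; have [|s [x [t' [cE sp xe]]]] := @split_colors c p (legs_in e); first lia.
have [|s' [y [t [tE sr yf]]]] := @split_colors t' r (legs_in f).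
  by move: h; rewrite cE !size_cat; lia.
rewrite {h}cE {t'}tE colorings_cons //.
have -> : s ++ x ++ s' ++ y ++ t = (s ++ x ++ s') ++ y ++ t by rewrite -!catA.
rewrite [RHS]colorings_cons //; last by rewrite !size_cat sp xe sr addnA.
transitivity (\sum_(x' <- colors_out e x) \sum_(y' <- colors_out f y)
  colorings D (s ++ x' ++ s' ++ y' ++ t)).
  rewrite !big_seq; apply: eq_bigr => x' x'E.
  have -> : s ++ x' ++ s' ++ y ++ t = (s ++ x' ++ s') ++ y ++ t by rewrite -!catA.
  rewrite colorings_cons //; last by rewrite !size_cat sp sr (size_colors_out x'E) addnA.
  by apply: eq_bigr => y' _; rewrite -!catA.
rewrite exchange_big; apply: eq_bigr => y' _.
by rewrite -!catA colorings_cons // -!catA.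
Qed.

(** Strands keep their colours at a crossing of any type, so a colouring depends
    only on how the arcs are connected, which local moves preserve; [braid] covers
    all moves with three crossings. *)
Lemma colorings_local (A B D : wdiagram) c :
  local_move A B -> wf A (size c) -> wf B (size c) ->
  colorings (A ++ D) c = colorings (B ++ D) c.
Proof.
have s1 i : i.+1 <= size c -> exists s a t, c = s ++ a :: t /\ size s = i.
  move=> h; have [|s [x [t [cE si]]]] := @split_colors c i 1; first lia.
  by case: x cE => [|a [|? ?]] // cE _; exists s, a, t.
have s2 i : i.+2 <= size c -> exists s a b t, c = s ++ a :: b :: t /\ size s = i.
  move=> h; have [|s [x [t [cE si]]]] := @split_colors c i 2; first lia.
  by case: x cE => [|a [|b [|? ?]]] // cE _; exists s, a, b, t.
have s3 i : i.+3 <= size c -> exists s a b d t, c = s ++ a :: b :: d :: t /\ size s = i.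
  move=> h; have [|s [x [t [cE si]]]] := @split_colors c i 3; first lia.
  by case: x cE => [|a [|b [|d [|? ?]]]] // cE _; exists s, a, b, d, t.
have braid i k1 k2 k3 l1 l2 l3 :
    wf [:: crossing k1 i.+1; crossing k2 i; crossing k3 i.+1] (size c) ->
    colorings ([:: crossing l1 i; crossing l2 i.+1; crossing l3 i] ++ D) c =
    colorings ([:: crossing k1 i.+1; crossing k2 i; crossing k3 i.+1] ++ D) c.
  rewrite wf_cons /= addn2 => /andP[/s3[s [x [y [z [t [-> si]]]]]] _].
  rewrite /= colorings_cross // [LHS]colorings_cross1 // [LHS]colorings_cross //.
  by rewrite [RHS]colorings_cross1 // colorings_cross // colorings_cross1.
case=> [e f p r|i|i|k i|k i|k i|k i|a b b' i _|i|b i|b i|b i|i|i|i];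
  try by move=> _; exact: braid.
- move=> _; rewrite !wf_cons /= => /andP[h1 /andP[h2 _]].
  apply: colorings_interchange; move: h1 h2.
  by case: e => [||?]; case: f => [||?] /=; lia.
- rewrite wf_cup => /andP[/s1[s [x [t [-> si]]]] _] _ /=.
  by rewrite colorings_cup1 // !colorings_cap //; case: x; rewrite ?addn0 ?add0n.
- rewrite wf_cup wf_cap => /and3P[_ h _] _ /=.
  have /s1[s [x [t [-> si]]]] : i < size c by lia.
  by rewrite colorings_cup // !colorings_cap1 //; case: x; rewrite ?addn0 ?add0n.
- rewrite wf_cons /= => _; rewrite wf_cup => /andP[/s1[s [x [t [-> si]]]] _].
  rewrite /= colorings_cup // colorings_cup1 // !colorings_cross1 //.
  by rewrite !colorings_cross.
- rewrite wf_cons /= addn2 => /andP[/s3[s [x [y [z [t [-> si]]]]]] _] _.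
  by rewrite /= colorings_cross1 // colorings_cap // colorings_cross // colorings_cap1.
- rewrite wf_cons /= addn2 => /andP[/s2[s [x [y [t [-> si]]]]] _] _.
  by rewrite /= colorings_cross // !colorings_cap // eq_sym.
- rewrite wf_cons /= addn2 => /andP[/s2[s [x [y [t [-> si]]]]] _] _.
  by rewrite /= !colorings_cross.
Qed.

Lemma colorings_eqv (A B : wdiagram) m c : eqv m A B -> wf A m -> size c = m ->
  colorings A c = colorings B c.
Proof.
move=> E; elim: E c => [Y Z [u A' B' v AB wA wB]|Y|Y Z YZ IH|Y Z T YZ IH1 ZT IH2] c wY cm //.
- elim: u m c wA wB cm {wY} => [|s u IH] m c.
    rewrite !cat0s !wf_cat => /andP[wA _] /andP[wB _] cm.
    by apply: colorings_local; rewrite ?cm.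
  rewrite !cat_cons !wf_cons -/(strands_after m s) => /andP[sm wA] /andP[_ wB] cm.
  rewrite !coloringsE !big_seq; apply: eq_bigr => c' c'E; apply: IH wA wB _.
  by rewrite -cm; apply: size_colors_above c'E; rewrite cm.
- by rewrite IH ?(proj1 (eqv_typ YZ)).
- by rewrite IH1 // IH2 // -(proj1 (eqv_typ YZ)).
Qed.

(** The colour of the new circle is arbitrary. *)
Lemma colorings_circle u p (v : wdiagram) c :
  wf (u ++ [:: (Cup, p); (Cap, p)] ++ v) (size c) ->
  colorings (u ++ [:: (Cup, p); (Cap, p)] ++ v) c = 2 * colorings (u ++ v) c.
Proof.
elim: u c => [|s u IH] c.
  rewrite cat0s wf_cup => /andP[h _].
  have [|s [x [t [-> sp x0]]]] := @split_colors c p 0; first lia.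
  case: x x0 => // _; rewrite !cat0s [[:: _; _] ++ _]/= colorings_cup //.
  by rewrite !colorings_cap // mul2n addnn.
rewrite cat_cons wf_cons -/(strands_after _ s) => /andP[sc wu].
rewrite cat_cons !coloringsE big_distrr /= !big_seq; apply: eq_bigr => c' c'E; apply: IH.
by rewrite (size_colors_above sc c'E).
Qed.

Lemma nseq_colors_above K (s : slice K) m x : s.2 + legs_in s.1 <= m ->
  nseq (strands_after m s) x \in colors_above s (nseq m x).
Proof.
case: s => e p /= h.
have -> : nseq m x = nseq p x ++ nseq (legs_in e) x ++ nseq (m - (p + legs_in e)) x.
  by rewrite -!nseqD; congr nseq; lia.
rewrite colors_aboveE ?size_nseq // /strands_after /=.
apply/mapP; exists (nseq (legs_out e) x).
  by case: e {h} => [||k] //=; case: x.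
by rewrite -!nseqD; congr nseq; lia.
Qed.

Lemma colorings_nseq K (D : diagram K) m x : wf D m -> 0 < colorings D (nseq m x).
Proof.
elim: D m => [|s D IH] m //; rewrite wf_cons => /andP[sm wD].
have h := IH _ wD.
rewrite coloringsE (big_rem _ (nseq_colors_above x sm)) /=.
by apply: leq_trans h _; exact: leq_addr.
Qed.

Lemma colorings_closed K (D : diagram K) : closed D -> 0 < size D -> 1 < colorings D [::].
Proof.
rewrite /closed tangleE; case: D => [|[e p] D] //=; rewrite wf_cons => /andP[/andP[/= h wD] _] _.
case: e h wD => [||k] /= h wD; [|lia|lia].
have -> : p = 0 by lia.
rewrite coloringsE /colors_above /= !big_cons big_nil addn0 /=.
have h1 := colorings_nseq true wD; have h2 := colorings_nseq false wD.
by move: h1 h2; rewrite /=; lia.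
Qed.

Definition unclassical (s : slice (option bool)) : bool :=
  if s.1 is Cross (Some _) then false else true.

Lemma first_cap (W : wdiagram) : all unclassical W -> ~~ all cup_or_v W ->
  exists C p R, W = C ++ (Cap, p) :: R /\ all cup_or_v C.
Proof.
elim: W => [|s W IH] //= /andP[us uW].
case: s us => [[||[b|]] p] //= _.
- move=> vW; have [C [q [R [-> vC]]]] := IH uW vW.
  by exists ((Cup, p) :: C), q, R.
- by move=> _; exists [::], p, W.
- move=> vW; have [C [q [R [-> vC]]]] := IH uW vW.
  by exists (welded p :: C), q, R.
Qed.

Lemma cup_or_v_out (W : wdiagram) m : all cup_or_v W -> wf W m -> m <= out W m.
Proof.
elim: W m => [|[[||[b|]] p] W IH] m //= vW; rewrite wf_cons out_cons => /andP[/= pm wW].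
  by have := IH _ vW wW; lia.
by have := IH _ vW wW; lia.
Qed.

(** An all-welded diagram with two colourings is a single trivial circle: a
    bridge slid down from its first cap either meets a cup, and removes both, or
    splits off a circle, which doubles the number of colourings. *)
Lemma welded_trivial_unclassical (W : wdiagram) : closed W -> all unclassical W ->
  colorings W [::] = 2 -> eqv 0 W trivial_diagram.
Proof.
elim: {W}_.+1 {-2}W (ltnSn (count (@is_cup _) W)) => // N IH W WN cW vW W2.
have [wW oW] : wf W 0 /\ out W 0 = 0.
  by move: cW; rewrite /closed tangleE => /andP[wW /eqP].
have [C [p [R [WE vC]]]] : exists C p R, W = C ++ (Cap, p) :: R /\ all cup_or_v C.
  apply: first_cap => //; apply/negP => cvW.
  case: W {WN cW vW} W2 wW oW cvW => [|[[||[b|]] p] W] //; rewrite wf_cons out_cons /=.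
    move=> _ /andP[_ wW] oW vW.
    by have := cup_or_v_out vW wW; rewrite oW.
  by move=> _ /andP[]; lia.
have [[wC pC] wR] : (wf C 0 /\ p.+2 <= out C 0) /\ wf R (out C 0).-2.
  by move: wW; rewrite WE wf_cat wf_cap => /and3P[-> -> ->].
have oR : out R (out C 0).-2 = 0 by move: oW; rewrite WE out_cat out_cap.
have WE' : W = (C ++ bridge p 0) ++ R by rewrite WE -catA.
have oCb : out (C ++ bridge p 0) 0 = (out C 0).-2 by rewrite out_cat out_cap.
have wCb : wf (C ++ bridge p 0) 0 by rewrite wf_cat wC wf_cap pC.
have vR : all unclassical R by move: vW; rewrite WE all_cat /= => /andP[].
have uc C' : all cup_or_v C' -> all unclassical C'.
  by apply: sub_all => -[[||[]] ?].
have pC' : p + 0.+2 <= out C 0 by rewrite addn2.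
case: (bridge_slide vC wC pC') => [[C' [vC' cC' E]]|[C1 [q [C2 [v1 v2 E]]]]].
  have {}E : eqv 0 W (C' ++ R) by rewrite WE'; apply: eqv_catr; rewrite ?oCb.
  apply: (eqv_trans E); apply: IH.
  - move: WN; rewrite WE !count_cat /=; move: cC'; lia.
  - by rewrite /closed tangleE (eqv_wf E wW) -(eqv_out E wW) oW.
  - by rewrite all_cat uc.
  - by rewrite -(colorings_eqv E wW).
have {}E : eqv 0 W (C1 ++ [:: (Cup, q); (Cap, q)] ++ C2 ++ R).
  rewrite WE'; have := @eqv_catr 0 R _ _ _ E; rewrite oCb -!catA; exact.
have wE := eqv_wf E wW; have oE := eqv_out E wW.
have C1n : colorings (C1 ++ C2 ++ R) [::] = 1.
  have := colorings_eqv (c := [::]) E wW erefl; rewrite W2 colorings_circle //.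
  by clear; move: (colorings _ _) => n; lia.
have cl : closed (C1 ++ C2 ++ R).
  rewrite /closed tangleE; move: wE oE; rewrite oW !wf_cat !out_cat.
  rewrite wf_cup out_cup wf_cap out_cap wf_nil out_nil /= => /andP[-> /andP[_ ->]] <-.
  exact: eqxx.
case: (posnP (size (C1 ++ C2 ++ R))) => [/size0nil C0|s0]; last first.
  by have := colorings_closed cl s0; rewrite C1n.
move: E wE; case: C1 {C1n cl v1 oE} C0 => //= ->.
rewrite wf_cup => E /andP[q0 _].
by have q0' : q = 0 by [lia]; rewrite q0' in E.
Qed.

(** * A knot has two colourings *)

(** A positive number of colourings is turned into an actual one, given line by
    line. *)
Lemma colorings_extend K (D : diagram K) c : 0 < colorings D c ->
  exists2 col : nat -> seq bool, col 0 = c &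
    forall l s, onth D l = Some s -> col l.+1 \in colors_above s (col l).
Proof.
elim: D c => [|s D IH] c; first by exists (fun=> c) => // l s; rewrite onth0n.
rewrite coloringsE => pos.
have /hasP[c' c'E /IH[col col0 colS]] : has (fun c' => 0 < colorings D c') (colors_above s c).
  rewrite -(negbK (has _ _)); apply: contraL pos => /hasPn h.
  by rewrite -eqn0Ngt big_seq big1 // => c' /h; rewrite -eqn0Ngt => /eqP.
exists (fun l => if l is l'.+1 then col l' else c) => //.
by case=> [|l] s' /=; [case=> <-; rewrite col0|exact: colS].
Qed.

Lemma pass_color K (s : slice K) c c' i j t :
  c' \in colors_above s c -> s.2 + legs_in s.1 <= size c -> i < size c ->
  pass s i = (t, j) -> nth true (if t then c' else c) j = nth true c i.
Proof.
case: s => e p c'E /= h ic; move: c'E.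
have [s [x [r [-> sp xe]]]] := split_colors h.
rewrite colors_aboveE // => /mapP[y yE ->].
have ye := size_colors_out yE.
case: (ltnP i p) => ip.
  by case=> <- <-; rewrite !nth_cat sp ip.
case: (leqP (p + legs_in e) i) => pi.
  case=> <- <-; rewrite !nth_cat sp xe ye.
  have -> : (i - legs_in e + legs_out e < p) = false by lia.
  have -> : (i < p) = false by lia.
  have -> : (i - legs_in e + legs_out e - p < legs_out e) = false by lia.
  have -> : (i - p < legs_in e) = false by lia.
  by congr nth; lia.
case: e xe yE ye h pi => [||k] /=; first by move=> *; lia.
  case: x => [|a [|b [|? ?]]] //= _; case: eqP => // <- _ _ _ pi.
  case=> <- <-; rewrite !nth_cat sp.
  have -> : (p + p.+1 - i < p) = false by lia.
  have -> : (i < p) = false by lia.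
  have [->|->] : i = p \/ i = p.+1 by lia.
    by rewrite subnn addKn subSnn.
  by rewrite addnK subnn subSnn.
case: x => [|a [|b [|? ?]]] //= _; rewrite inE => /eqP-> _ _ pi.
case=> <- <-; rewrite !nth_cat sp.
have -> : (p + p.+1 - i < p) = false by lia.
have -> : (i < p) = false by lia.
have [->|->] : i = p \/ i = p.+1 by lia.
  by rewrite subnn addKn subSnn.
by rewrite addnK subnn subSnn.
Qed.

Lemma cup_color K p c c' : c' \in colors_above (@Cup K, p) c -> p <= size c ->
  nth true c' p = nth true c' p.+1.
Proof.
move=> c'E pc; have [|s [x [r [cE sp]]]] := @split_colors c p 0; first lia.
case: x cE => // cE _; move: c'E; rewrite cE (@colors_aboveE _ Cup _ _ [::]) //.
have pp : (p.+1 < p) = false by lia.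
by move=> /mapP[y]; rewrite !inE => /orP[]/eqP-> ->; rewrite !nth_cat sp ltnn pp subnn subSnn.
Qed.

Lemma travel_color K (D : diagram K) (col : nat -> seq bool) x :
  wf D 0 -> col 0 = [::] ->
  (forall l s, onth D l = Some s -> col l.+1 \in colors_above s (col l)) ->
  on_strand D x ->
  nth true (col (travel D x).1.1) (travel D x).1.2 = nth true (col x.1.1) x.1.2.
Proof.
move=> wD col0 colS.
have sz l : l <= size D -> size (col l) = width D l.
  elim: l => [|l IH] lD; first by rewrite col0 widthE take0.
  case sE: (onth D l) (onthTE D l) => [s|]; rewrite ?lD // => _.
  rewrite (widthS sE) -IH; last exact: ltnW.
  by apply: size_colors_above (colS _ _ sE); rewrite IH ?onth_fits // ltnW.
case: x => -[l i] up; rewrite /on_strand [_.1.2]/= [_.1.1]/= => il; case: up; last first.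
  case: l il => [|l il]; first by rewrite widthE take0.
  case sE: (onth D l) => [s|]; last by rewrite /travel /slice_ahead [l.+1.-1]/= sE.
  rewrite (travel_down _ sE); have fs := onth_fits wD sE.
  have lD := onth_lt sE; have cS := colS _ _ sE; have szl := sz l (ltnW lD).
  case ps: (pass _ i) => [[] j] /=.
    rewrite (widthS sE) in il; have [{}ps jl] := pass_upside_down fs il ps.
    by rewrite (pass_color cS _ _ ps) ?szl.
  have [q sq [iq ->]] := pass_upside_down_turn ps; subst s.
  have e := cup_color cS; rewrite szl in e; rewrite /= addn0 in fs; have {}e := e fs.
  have [->|->] : i = q \/ i = q.+1 by lia.
    by rewrite addKn.
  by rewrite addnK.
case sE: (onth D l) => [s|]; last by rewrite /travel /slice_ahead sE.
rewrite (travel_up _ sE); have fs := onth_fits wD sE.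
have lD := onth_lt sE; have cS := colS _ _ sE; have szl := sz l (ltnW lD).
case ps: (pass s i) => [[] j] /=; first by rewrite (pass_color cS _ _ ps) ?szl.
by have := pass_color cS _ _ ps => /= ->; rewrite ?szl.
Qed.

Lemma uniq_colors_above K (s : slice K) c : uniq (colors_above s c).
Proof.
rewrite map_inj_uniq => [|x y /eqP]; first by case: s.1 => [||k] //=; case: ifP.
rewrite eqseq_cat // eqxx => /eqP E.
have /eqP := congr1 rev E; rewrite !rev_cat eqseq_cat // eqxx => /eqP.
exact: (can_inj revK).
Qed.

(** A colouring of a knot is constant along the travel, hence constant. So the
    only choice is that of the colour of the first cup. *)
Lemma knot_colorings K (D : diagram K) : knot_diagram D -> colorings D [::] = 2.
Proof.
move=> [cD sD reach]; have [wD oD] : wf D 0 /\ out D 0 = 0.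
  by move: cD; rewrite /closed tangleE => /andP[wD /eqP].
have wdrop h : wf (drop h D) (width D h).
  by move: wD; rewrite -{1}(cat_take_drop h D) wf_cat => /andP[].
(* A colouring which is constant up to line h but not on line h.+1 is absurd. *)
have absurd h x c s : 0 < h -> onth D h = Some s ->
    c \in colors_above s (nseq (width D h) x) -> 0 < colorings (drop h.+1 D) c ->
    0 < width D 1 -> all (pred1 x) c.
  move=> h0 sE cE /colorings_extend[col col0 colS] w1.
  have hD := onth_lt sE; have fs := onth_fits wD sE.
  pose full l := if l <= h then nseq (width D l) x else col (l - h.+1).
  have f0 : full 0 = [::] by rewrite /full leq0n widthE take0.
  have fS l s' : onth D l = Some s' -> full l.+1 \in colors_above s' (full l).
    move=> lE; rewrite /full; case: (ltngtP l h) => lh.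
    - by rewrite (widthS lE); apply: nseq_colors_above; exact: onth_fits lE.
    - rewrite subSn //; apply: colS; rewrite -lE -[in RHS](cat_take_drop h.+1 D).
      by rewrite onth_cat size_takel // ltnNge lh.
    by move: lE; rewrite lh sE => -[<-]; rewrite subnn col0.
  have fc y k : on_strand D y -> nth true (full (iter k (travel D) y).1.1) (iter k (travel D) y).1.2
      = nth true (full y.1.1) y.1.2.
    move=> yD; elim: k => //= k <-; apply: travel_color => //; exact: iter_on_strand.
  have full1 : full h.+1 = c by rewrite /full ltnn subnn.
  have sc : size c = width D h.+1.
    by rewrite (widthS sE) (size_colors_above _ cE) size_nseq.
  apply/(all_nthP true) => i ic; rewrite sc in ic.
  have [k kE] := reach 1 0 h.+1 i w1 ic.
  have := fc (1, 0, true) k w1; rewrite [(iter _ _ _).1]kE /= full1 => ->.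
  by rewrite /full h0 nth_nseq w1.
have [s1 [D1 D1E]] : exists s D', D = s :: D' by case: (D) sD => // s D' _; exists s, D'.
have w1 : 0 < width D 1.
  move: wD; rewrite D1E wf_cons /width /= take0 /= => /andP[+ _].
  by case: s1 {D1E} => [[||k] p]; rewrite /strands_after //=; lia.
have const n h x : size D - h <= n -> 0 < h -> h <= size D ->
    colorings (drop h D) (nseq (width D h) x) = 1.
  elim: n h => [|n IH] h hn h0 hD; first by rewrite drop_oversize //; lia.
  case: (ltngtP h (size D)) => [hlt|hgt|->]; [|lia|by rewrite drop_size].
  case sE: (onth D h) (onthTE D h) => [s|]; rewrite hlt // => _.
  rewrite (drop_nth s hlt) -(odflt_onth s) sE /= coloringsE.
  have nE := nseq_colors_above x (onth_fits wD sE).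
  have hn' : size D - h.+1 <= n by clear -hn; lia.
  rewrite (bigD1_seq _ nE (uniq_colors_above _ _)) -(widthS sE) (IH h.+1) //.
  rewrite big_seq_cond big1 // => c /andP[cE cn]; apply/eqP; rewrite -leqn0 leqNgt.
  apply: contra cn => /(absurd h x c s h0 sE cE)-/(_ w1)/all_pred1P->.
  by rewrite (size_colors_above _ cE) size_nseq ?(widthS sE) // onth_fits.
have wD1 : s1.2 + legs_in s1.1 <= 0 by move: wD; rewrite D1E wf_cons => /andP[].
have sc : exists p, s1 = (Cup, p).
  by case: s1 wD1 {D1E} => [[||k] p] /=; [exists p|lia|lia].
case: sc => p s1E; rewrite s1E /= in wD1.
have c1 x := const (size D) 1 x (leq_subr _ _) isT sD.
have w2 : width D 1 = 2 by rewrite /width D1E /= take0 s1E.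
rewrite w2 D1E /= drop0 in c1.
have p0 : p = 0 by clear -wD1; lia.
rewrite D1E s1E p0 coloringsE /colors_above /= !big_cons big_nil addn0 /=.
by rewrite (c1 true) (c1 false).
Qed.

(** * Changing crossings *)

Definition forget K (s : slice K) : slice unit := (map_shape (fun=> tt) s.1, s.2).

Lemma size_recross K L (D : diagram K) (f : 'I_(size D) -> K -> L) :
  size (recross f) = size D.
Proof. by rewrite size_map size_enum_ord. Qed.

Lemma onth_recross K L (D : diagram K) (f : 'I_(size D) -> K -> L) (h : 'I_(size D)) :
  onth (recross f) h = omap (fun s => (map_shape (f h) s.1, s.2)) (onth D h).
Proof.
have hE : onth (enum 'I_(size D)) h = Some h.
  by rewrite onthE (nth_map h) ?size_enum_ord // nth_ord_enum.
rewrite onth_map hE /= (tnth_nth (tnth (in_tuple D) h)) /=.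
rewrite -odflt_onth; case: (onth D h) (onthTE D h) => [s|] //= hD.
by have := ltn_ord h; rewrite -hD.
Qed.

Lemma recross_forget K L (D : diagram K) (f : 'I_(size D) -> K -> L) :
  map (@forget L) (recross f) = map (@forget K) D.
Proof.
apply: eq_from_onth => h; rewrite (onth_map _ (recross f)) (onth_map _ D).
case: (ltnP h (size D)) => hD; last first.
  by rewrite (onth_default hD) onth_default // size_recross.
rewrite (onth_recross f (Ordinal hD)) /=.
by case: (onth D h) => [[[||k] p]|].
Qed.

Lemma projectionE K (D : diagram K) : projection D = map (@forget K) D.
Proof.
rewrite -(recross_forget (fun (_ : 'I_(size D)) _ => tt)) -[LHS]map_id.
by apply: eq_map => -[[||[]] p].
Qed.

(** Travel, regions and typing depend on the shape only, which crossing changes and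
    welding preserve. *)
Definition same_shape K L (D : diagram K) (E : diagram L) : Prop :=
  map (@forget K) D = map (@forget L) E.

Lemma same_shape_size K L (D : diagram K) (E : diagram L) :
  same_shape D E -> size D = size E.
Proof. by move/(congr1 size); rewrite !size_map. Qed.

Lemma width_forget K (D : diagram K) h : width (map (@forget K) D) h = width D h.
Proof.
rewrite /width -map_take; elim: (take h D) 0 => //= -[e p] A IH m.
by rewrite IH /strands_after /=; case: e.
Qed.

Lemma same_shape_width K L (D : diagram K) (E : diagram L) h :
  same_shape D E -> width D h = width E h.
Proof. by move=> DE; rewrite -width_forget DE width_forget. Qed.

Lemma tangle_forget K (D : diagram K) m n : tangle (map (@forget K) D) m n = tangle D m n.
Proof. by elim: D m => [|[[||k] p] D IH] m //=; rewrite -IH. Qed.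

Lemma same_shape_closed K L (D : diagram K) (E : diagram L) :
  same_shape D E -> closed D = closed E.
Proof. by move=> DE; rewrite /closed -tangle_forget DE tangle_forget. Qed.

Lemma travel_forget K (D : diagram K) x : travel (map (@forget K) D) x = travel D x.
Proof.
case: x => -[h i] up; rewrite /travel /slice_ahead onth_map.
by case: (onth D _) => [[[||k] p]|] //; case: up.
Qed.

Lemma same_shape_travel K L (D : diagram K) (E : diagram L) x :
  same_shape D E -> travel D x = travel E x.
Proof. by move=> DE; rewrite -travel_forget DE travel_forget. Qed.

Lemma same_shape_iter K L (D : diagram K) (E : diagram L) k x :
  same_shape D E -> iter k (travel D) x = iter k (travel E) x.
Proof. by move=> DE; elim: k => //= k ->; exact: same_shape_travel. Qed.

Lemma same_shape_knot K L (D : diagram K) (E : diagram L) :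
  same_shape D E -> knot_diagram D -> knot_diagram E.
Proof.
move=> DE [cD sD reach]; split; rewrite -?(same_shape_closed DE) -?(same_shape_size DE) //.
move=> h i h' i'; rewrite -!(same_shape_width _ DE) => hi hi'.
by have [k kE] := reach h i h' i' hi hi'; exists k; rewrite -(same_shape_iter _ _ DE).
Qed.

(** * Travelling back *)

Arguments travel : simpl never.
Arguments passage : simpl never.

Definition back (x : position) : position := (x.1, ~~ x.2).

Lemma backK : involutive back.
Proof. by case=> y up; rewrite /back /= negbK. Qed.

Lemma on_strand_back K (D : diagram K) x : on_strand D (back x) = on_strand D x.
Proof. by []. Qed.

Definition ahead (x : position) : nat := if x.2 then x.1.1 else x.1.1.-1.

Lemma slice_aheadE K (D : diagram K) x : slice_ahead D x = onth D (ahead x).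
Proof. by case: x => -[h i] up. Qed.

Lemma pass_back K (s : slice K) i j m : s.2 + legs_in s.1 <= m -> i < m ->
  pass s i = (true, j) -> pass (upside_down s) j = (true, i).
Proof.
case: s => [[||k] q] /= fs im; case: (ltnP i q) => ?;
  try case: (leqP (q + _) i) => ?; case=> // jE; case: (ltnP j q) => ?;
  try case: (leqP (q + _) j) => ?; try lia; congr pair; lia.
Qed.

Lemma pass_turn_back K (s : slice K) i j : pass s i = (false, j) -> pass s j = (false, i).
Proof.
move=> /pass_turn[q -> [iq ->]] /=.
have -> : (q + q.+1 - i < q) = false by lia.
have -> : (q + 2 <= q + q.+1 - i) = false by lia.
by congr pair; lia.
Qed.

Lemma on_strand_ahead K (D : diagram K) x : closed D -> on_strand D x ->
  exists s, onth D (ahead x) = Some s.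
Proof.
rewrite /closed tangleE => /andP[_ /eqP oD].
case: x => -[h i] []; rewrite /on_strand /ahead /= => ih.
  case: (ltnP h (size D)) => hD; last by move: ih; rewrite widthE take_oversize // oD.
  by case E: (onth D h) (onthTE D h) => [s|]; rewrite hD // => _; exists s.
case: h ih => [|h]; first by rewrite widthE take0.
case: (ltnP h (size D)) => hD; last by rewrite widthE take_oversize ?oD //; lia.
by case E: (onth D h) (onthTE D h) => [s|]; rewrite hD // => _; exists s.
Qed.

Lemma travel_back K (D : diagram K) x : closed D -> on_strand D x ->
  travel D (back (travel D x)) = back x /\ ahead (back (travel D x)) = ahead x.
Proof.
move=> cD xD; have [s sE] := on_strand_ahead cD xD.
have wD : wf D 0 by move: cD; rewrite /closed tangleE => /andP[].
case: x xD sE => -[h i] []; rewrite /on_strand /ahead [_.1.2]/= [_.1.1]/= [_.2]/= => ih sE.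
  have fs := onth_fits wD sE.
  rewrite (travel_up _ sE); case ps: (pass s i) => [[] j]; rewrite /back /=.
    by rewrite (travel_down _ sE) (pass_back fs ih ps).
  by rewrite (travel_up _ sE) (pass_turn_back ps).
case: h ih sE => [|h]; first by rewrite widthE take0.
rewrite [h.+1.-1]/= => ih sE; have fs := onth_fits wD sE.
rewrite (travel_down _ sE); case ps: (pass _ i) => [[] j]; rewrite /back /=.
  rewrite (widthS sE) in ih; have [{}ps _] := pass_upside_down fs ih ps.
  by rewrite (travel_up _ sE) ps.
by rewrite (travel_down _ sE) (pass_turn_back ps).
Qed.

Lemma passageE (D : diagram bool) x : passage D x =
  if onth D (ahead x) is Some (Cross b, p) then
    if p <= x.1.2 < p.+2 then Some (b == (x.1.2 == if x.2 then p else p.+1)) else None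
  else None.
Proof. by case: x => -[h i] up. Qed.

Lemma passage_back (D : diagram bool) x : closed D -> on_strand D x ->
  passage D (back (travel D x)) = passage D x.
Proof.
move=> cD xD; have [s sE] := on_strand_ahead cD xD.
have wD : wf D 0 by move: cD; rewrite /closed tangleE => /andP[].
rewrite !passageE (proj2 (travel_back cD xD)) sE.
case: s sE => [[||b] p] // sE.
case: x xD sE => -[h i] []; rewrite /on_strand /ahead [_.1.2]/= [_.1.1]/= [_.2]/= => ih sE.
  rewrite (travel_up _ sE) pass_cross /back /=.
  have -> : (p <= swap p i < p.+2) = (p <= i < p.+2) by rewrite /swap; ifs.
  case: ifP => // pi; congr (Some (_ == _)).
  by rewrite /swap; ifs.
case: h ih sE => [|h]; first by rewrite widthE take0.
rewrite [h.+1.-1]/= => ih sE; rewrite (travel_down _ sE).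
have -> : upside_down (Cross b, p) = (Cross b, p) by [].
rewrite pass_cross /back /=.
have -> : (p <= swap p i < p.+2) = (p <= i < p.+2) by rewrite /swap; ifs.
case: ifP => // pi; congr (Some (_ == _)).
by rewrite /swap; ifs.
Qed.

(** The two positions from which a crossing is entered on its over strand, or on
    its under strand, are each other's way back. *)
Lemma same_visit (D : diagram bool) x y o : closed D ->
  on_strand D x -> on_strand D y -> ahead x = ahead y ->
  passage D x = Some o -> passage D y = Some o ->
  x = y \/ x = back (travel D y).
Proof.
move=> cD xD yD xy; rewrite !passageE -xy.
case sE: (onth D (ahead x)) => [[[||b] p]|] //.
case: ifP => // xp [xo]; case: ifP => // yp [yo].
case: x xD xy xp xo sE => -[h i] up; case: y yD yp yo => -[h' i'] up'.
rewrite /on_strand /ahead [_.1.2]/= [_.1.1]/= [_.2]/= => yD yp yo.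
rewrite /on_strand /ahead [_.1.2]/= [_.1.1]/= [_.2]/= => xD xy xp xo sE.
have io : (i == (if up then p else p.+1)) = (i' == (if up' then p else p.+1)).
  by move: xo; rewrite -yo; move: (i == _) (i' == _) => [] []; case: (b).
have h0 k : k < width D 0 -> False by rewrite widthE take0.
case: up up' xD yD xy sE io {xo yo} => -[] xD yD.
- by move=> -> sE io; left; congr (_, _, _); lia.
- case: h' yD => [/h0//|h'] yD /= -> sE io; right.
  rewrite (travel_down _ sE) (_ : upside_down _ = (Cross b, p)) // pass_cross /back /=.
  by congr (_, _, _); rewrite /swap; ifs.
- case: h xD => [/h0//|h] xD /= -> sE io; right.
  rewrite (travel_up _ sE) pass_cross /back /=.
  by congr (_, _, _); rewrite /swap; ifs.
- case: h xD => [/h0//|h] xD; case: h' yD => [/h0//|h'] yD /= -> sE io; left.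
  by congr (_, _, _); lia.
Qed.

Lemma passage_lt (D : diagram bool) x o : passage D x = Some o -> ahead x < size D.
Proof.
rewrite passageE; case sE: (onth D (ahead x)) => [s|] // _; exact: onth_lt sE.
Qed.

(** The reachability in [knot_diagram] disregards the direction of arrival. If the
    traveller arrives at an end of the strand from the side of the crossing, then
    the crossing has just been passed. *)
Lemma reach_passage (D : diagram bool) h p b o y : knot_diagram D ->
  onth D h = Some (Cross b, p) -> on_strand D y ->
  exists k, ahead (iter k (travel D) y) = h /\ passage D (iter k (travel D) y) = Some o.
Proof.
move=> [cD _ reach] sE.
have wD : wf D 0 by move: cD; rewrite /closed tangleE => /andP[].
have fs := onth_fits wD sE.
pose i := if b == o then p else p.+1.
have iw : i < width D h by move: fs; rewrite /i /=; case: ifP; lia.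
have ip : p <= i < p.+2 by rewrite /i; case: ifP; lia.
have bi : (b == (i == p)) = o.
  by rewrite /i; case: (b); case: (o) => /=; lia.
(* From an upward position the bottom end of the strand is reached; if it is
   reached downwards, the crossing has just been traversed. *)
have upw l j : on_strand D (l, j, true) -> exists k,
    ahead (iter k (travel D) (l, j, true)) = h /\
    passage D (iter k (travel D) (l, j, true)) = Some o.
  move=> lj; have [k kE] := reach l j h i lj iw.
  case E: (iter k (travel D) (l, j, true)) kE => [x up] /= xE; subst x.
  case: up E => E.
    by exists k; rewrite E passageE /ahead /= sE ip bi.
  case: k E => [|k] //; rewrite iterS => E; exists k.
  set z := iter k _ _ in E *; have zD : on_strand D z by exact: iter_on_strand.
  have [_ az] := travel_back cD zD; have pz := passage_back cD zD.
  by rewrite -az -pz E /back passageE /ahead /= sE ip bi.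
case: y => -[l j] []; first exact: upw.
elim: l j => [|l IH] j; rewrite /on_strand /=; first by rewrite widthE take0.
move=> lj; have := travel_on_strand (x := (l.+1, j, false)) wD lj.
have [s lE] := on_strand_ahead (x := (l.+1, j, false)) cD lj; rewrite /ahead /= in lE.
case E: (travel D (l.+1, j, false)) => [[l' j'] []] zD.
  have [k kE] := upw _ _ zD; exists k.+1; by rewrite iterSr E.
have l'E : l' = l by move: E; rewrite (travel_down _ lE); case: ifP => _ [].
by subst l'; have [k kE] := IH _ zD; exists k.+1; rewrite iterSr E.
Qed.

(** * Times of the passages *)

Section Times.

Variables (D : diagram bool) (h0 p0 : nat) (b0 : bool).
Hypothesis knotD : knot_diagram D.
Hypothesis h0E : onth D h0 = Some (Cross b0, p0).

Let cD : closed D. Proof. by case: knotD. Qed.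
Let wD : wf D 0. Proof. by move: cD; rewrite /closed tangleE => /andP[]. Qed.

(** Starting with the over passage of the crossing of slice h0 makes it one which is
    passed over first ([time_h0]). *)
Definition at_time (t : nat) : position :=
  iter t (travel D) (h0, if b0 then p0 else p0.+1, true).

Definition visits (c : nat) (o : bool) (x : position) : bool :=
  (ahead x == c) && (passage D x == Some o).

Definition crossing_at (c : nat) : bool :=
  if onth D c is Some (Cross _, _) then true else false.

Lemma at_timeD t j : iter j (travel D) (at_time t) = at_time (t + j).
Proof. by rewrite addnC /at_time iterD. Qed.

Lemma at_time_on t : on_strand D (at_time t).
Proof.
apply: iter_on_strand => //; have := onth_fits wD h0E.
by rewrite /on_strand /=; case: (b0); lia.
Qed.

Lemma visits_at0 : visits h0 true (at_time 0).
Proof.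
rewrite /visits passageE /at_time /ahead /= h0E eqxx.
by case: (b0); case: ifP => [_|]; rewrite ?eqxx ?(gtn_eqF (ltnSn p0)) //; lia.
Qed.

Lemma visit_exists c o : exists t, crossing_at c ==> visits c o (at_time t).
Proof.
rewrite /crossing_at; case cE: (onth D c) => [[[||b] p]|]; try by exists 0.
have [t [h1 h2]] := reach_passage o knotD cE (at_time_on 0).
by exists t; rewrite /visits /at_time h1 h2 !eqxx.
Qed.

(** The travel is periodic; the least time is the one during the first tour of the
    knot. *)
Definition time (c : nat) (o : bool) : nat := ex_minn (visit_exists c o).

Lemma time_visits c o : crossing_at c -> visits c o (at_time (time c o)).
Proof. by rewrite /time; case: ex_minnP => t /implyP. Qed.

Lemma time_min c o t : visits c o (at_time t) -> time c o <= t.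
Proof. by rewrite /time; case: ex_minnP => t' _ m v; apply: m; rewrite v implybT. Qed.

Definition over_first (c : nat) : bool := time c true < time c false.

(** A curl, as removed by move I. Only those passed under first are considered, the
    others being of the kind [over_first]. *)
Definition kink (c : nat) : bool :=
  (time c false < time c true) &&
  [forall t : 'I_(time c true), (time c false < t) ==> (passage D (at_time t) == None)].

Lemma visits_back c o x : on_strand D x -> visits c o (back (travel D x)) = visits c o x.
Proof. by move=> xD; rewrite /visits (travel_back cD xD).2 passage_back. Qed.

Lemma time_h0 : over_first h0.
Proof.
have c0 : crossing_at h0 by rewrite /crossing_at h0E.
have := time_min visits_at0; rewrite leqn0 => /eqP t0; rewrite /over_first t0 lt0n.
apply: contraTneq (time_visits false c0) => ->; apply/negP => /andP[_ /eqP v].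
by have /andP[_ /eqP] := visits_at0; rewrite v.
Qed.

(** Here c is passed under first, and left along its under strand in the direction
    of the travel or against it. In the former case the crossing c' is the first one
    met after the time of c, so it is passed over before c is, or it is c itself and
    c is a kink. In the latter case c' is met just before the time of c: the walk does
    not go back beyond the start of the travel, which is an over passage. *)
Lemma time_next c c' y k : crossing_at c -> ~~ over_first c -> on_strand D y ->
  visits c false (back y) ->
  (forall j, j < k -> passage D (iter j (travel D) y) = None) ->
  visits c' true (iter k (travel D) y) ->
  kink c \/ time c' true < time c true.
Proof.
move=> cc nc yD vy none vz.
set u := time c false; set o := time c true.
have /andP[/eqP au /eqP pu] := time_visits false cc; rewrite -/u in au pu.
have /andP[/eqP ao /eqP po] := time_visits true cc; rewrite -/o in ao po.
have uo : u < o.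
  rewrite ltn_neqAle leqNgt nc andbT; apply/eqP => e.
  by move: pu; rewrite e po.
have yb : on_strand D (back y) by rewrite on_strand_back.
have /andP[/eqP ay /eqP py] := vy.
have yE : travel D (back (travel D (back y))) = y.
  by rewrite (travel_back cD yb).1 backK.
have [xu|xu] := same_visit cD (at_time_on u) yb (etrans au (esym ay)) pu py; last first.
  (* The travel leaves c along y. *)
  have xE j : at_time (u.+1 + j) = iter j (travel D) y.
    by rewrite addSnnS -at_timeD xu iterSr yE.
  have c'k : time c' true <= u.+1 + k by apply: time_min; rewrite xE.
  have ok : u.+1 + k <= o.
    rewrite leqNgt; apply/negP => h.
    have := none (o - u.+1); rewrite -xE subnKC // po => e.
    by have /e : o - u.+1 < k by lia.
  have [e|] := eqVneq o (u.+1 + k); last by right; lia.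
  left; rewrite /kink uo; apply/forallP => t; apply/implyP => ut.
  have tl := ltn_ord t; rewrite -/o in tl.
  have := none (t - u.+1); rewrite -xE subnKC // => -> //.
  by rewrite ltn_subLR // -e.
(* The travel arrives at c against y. *)
have xE j : j <= u -> iter j (travel D) y = back (at_time (u - j)).
  elim: j => [|j IH] ju; first by rewrite subn0 xu backK.
  rewrite iterS IH; last exact: ltnW.
  have -> : u - j = (u - j.+1).+1 by lia.
  exact: (travel_back cD (at_time_on _)).1.
have u0 : 0 < u.
  rewrite lt0n; apply/eqP => e; have /andP[_ /eqP] := visits_at0.
  by rewrite -e pu.
case: (ltnP k u) => ku.
  right; have : time c' true <= u - k.+1; last by lia.
  apply: time_min; rewrite -visits_back; last exact: at_time_on.
  have -> : travel D (at_time (u - k.+1)) = at_time (u - k) by rewrite -(subnSK ku).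
  by rewrite -xE // ltnW.
have := none u.-1; rewrite xE ?leq_pred // prednK // => /(_ ku).
have -> : u - u.-1 = 1 by lia.
have /andP[_ /eqP v0] := visits_at0.
by have := passage_back cD (at_time_on 0); rewrite v0 => ->.
Qed.

End Times.

(** * Regions and the strands on their boundaries *)

Lemma region_closed (P : diagram unit) (A : {set gap P}) x y :
  A \in regions P -> x \in A -> same_region x y -> y \in A.
Proof.
move=> /imsetP[z _ ->]; rewrite !inE /= => zx xy.
exact: connect_trans zx xy.
Qed.

Lemma region_nonempty (P : diagram unit) (A : {set gap P}) :
  A \in regions P -> exists x, x \in A.
Proof. by move=> /imsetP[z _ ->]; exists z; rewrite !inE /=; exact: connect0. Qed.

Lemma gap_above_region (P : diagram unit) (A : {set gap P}) x y :
  A \in regions P -> gap_above x y -> (x \in A) = (y \in A).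
Proof.
move=> AP xy; apply/idP/idP => h; apply: (region_closed AP h).
  by apply: connect1; rewrite xy.
by apply: connect1; rewrite xy orbT.
Qed.

Lemma gap_aboveI (P : diagram unit) (x y : gap P) s :
  onth P (tag x) = Some s -> tag y = (tag x).+1 :> nat ->
  gaps_meet s (tagged x) (tagged y) -> gap_above x y.
Proof. by move=> sE /eqP yx m; rewrite /gap_above sE yx m. Qed.

(** Plain numbers in place of the dependent indices of [gap]. *)
Definition in_region (P : diagram unit) (A : {set gap P}) (l g : nat) : bool :=
  [exists x in A, (tag x == l :> nat) && (tagged x == g :> nat)].

Lemma in_region_meet (P : diagram unit) (A : {set gap P}) l s g j :
  A \in regions P -> onth P l = Some s -> gaps_meet s g j ->
  g <= width P l -> j <= width P l.+1 ->
  in_region A l g = in_region A l.+1 j.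
Proof.
move=> AP sE gj gl jl; have lP := onth_lt sE.
have l1 : l < (size P).+1 by exact: ltnW.
pose x : gap P := existT _ (Ordinal l1) (Ordinal (gl : g < (width P (Ordinal l1)).+1)).
have l2 : l.+1 < (size P).+1 by [].
pose y : gap P := existT _ (Ordinal l2) (Ordinal (jl : j < (width P (Ordinal l2)).+1)).
apply/existsP/existsP => -[z /and3P[zA /eqP zl /eqP zg]].
  exists y; rewrite /= !eqxx !andbT -(gap_above_region (x := z) AP) //.
  by apply: (@gap_aboveI _ _ _ s); rewrite /= ?zl ?zg.
exists x; rewrite /= !eqxx !andbT (gap_above_region (y := z) AP) //.
by apply: (@gap_aboveI _ _ _ s); rewrite /= ?zl ?zg.
Qed.

(** The gap on the left (s = true) or on the right of the traveller. *)
Definition side_in (P : diagram unit) (A : {set gap P}) (s : bool) (x : position) : bool :=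
  in_region A x.1.1 (if x.2 == s then x.1.2 else x.1.2.+1).

Section Regions.

Variable D : diagram bool.
Hypothesis knotD : knot_diagram D.
Let P := projection D.
Let cD : closed D. Proof. by case: knotD. Qed.
Let wD : wf D 0. Proof. by move: cD; rewrite /closed tangleE => /andP[]. Qed.

Lemma width_projection l : width P l = width D l.
Proof. by rewrite /P projectionE width_forget. Qed.

Lemma onth_projection_map l : onth P l = omap (@forget _) (onth D l).
Proof. by rewrite /P projectionE onth_map. Qed.

Lemma onth_projection l s : onth D l = Some s -> onth P l = Some (forget s).
Proof. by rewrite onth_projection_map => ->. Qed.

(** A strand of a crossing has other regions beside it after the crossing. *)
Definition avoids (s : slice bool) (i : nat) : bool :=
  if s.1 is Cross _ then ~~ (s.2 <= i < s.2.+2) else true.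

Lemma gaps_meet_through (s : slice bool) i j r : r <= 1 ->
  pass s i = (true, j) -> avoids s i -> gaps_meet (forget s) (r + i) (r + j).
Proof.
move=> r1; rewrite /avoids; case: s => -[||b] p /=; case: (ltnP i p) => ?;
  try case: (leqP (p + _) i) => ?; case=> // <-; lia.
Qed.

(** Left and right are those of the traveller, so at a maximum or a minimum one side
    is the gap between the two legs, before and after; on the other side the gaps
    outside the two legs are joined on the next line. *)
Lemma side_travel (A : {set gap P}) s x : A \in regions P ->
  on_strand D x -> passage D x = None ->
  side_in A s x = side_in A s (travel D x).
Proof.
move=> AP xD; have [e eE] := on_strand_ahead cD xD.
rewrite passageE eE => none.
have PE := onth_projection eE; have fs := onth_fits wD eE.
have no : avoids e x.1.2.
  by rewrite /avoids; move: none; case: (e) => [[||b] p] //=; case: ifP.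
case: x xD none no eE PE fs => -[l i] []; rewrite /on_strand /ahead [_.1.2]/= [_.1.1]/= [_.2]/=.
  move=> il none no eE PE fs; rewrite (travel_up _ eE).
  case ps: (pass e i) => [[] j]; rewrite /side_in /=.
    have jl := pass_lt fs ps il; rewrite -(widthS eE) in jl.
    have g0 := gaps_meet_through (leq0n 1) ps no; have g1 := gaps_meet_through (leqnn 1) ps no.
    rewrite !add0n in g0; rewrite !add1n in g1.
    by case: s => /=; [apply: in_region_meet AP PE g0 _ _|apply: in_region_meet AP PE g1 _ _];
      rewrite width_projection //; apply: ltnW.
  have [q eq [iq ->]] := pass_turn ps; subst e; rewrite /= in fs PE.
  have wS := widthS eE; rewrite /strands_after /= in wS.
  have m1 : gaps_meet (forget (@Cap bool, q)) q q by rewrite /= leqnn eqxx.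
  have m2 : gaps_meet (forget (@Cap bool, q)) q.+2 q by rewrite /=; lia.
  have e1 : in_region A l q = in_region A l q.+2.
    rewrite (in_region_meet AP PE m1) ?(in_region_meet AP PE m2) ?width_projection //; lia.
  have [->|->] : i = q \/ i = q.+1 by lia.
    by rewrite addKn; case: s => /=.
  by rewrite addnK; case: s => /=.
case: l => [|l]; first by rewrite widthE take0.
rewrite [l.+1.-1]/= => il none no eE PE fs; rewrite (travel_down _ eE).
case ps: (pass (upside_down e) i) => [[] j]; rewrite /side_in /=.
  have il' := il; rewrite (widthS eE) in il.
  have [{}ps jl] := pass_upside_down fs il ps.
  have no' : avoids e j.
    rewrite /avoids in no *; move: ps no; case: (e) => [[||b] p] //=; rewrite -/(pass (Cross b, p) j) pass_cross.
    by case=> <-; rewrite /swap; ifs.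
  have g0 := gaps_meet_through (leq0n 1) ps no'; have g1 := gaps_meet_through (leqnn 1) ps no'.
  rewrite !add0n in g0; rewrite !add1n in g1.
  by symmetry; case: s => /=; [apply: in_region_meet AP PE g1 _ _|apply: in_region_meet AP PE g0 _ _];
    rewrite width_projection //; apply: ltnW.
have [q eq [iq ->]] := pass_upside_down_turn ps; subst e; rewrite /= in fs PE.
have wS := widthS eE; rewrite /strands_after /= in wS.
have m1 : gaps_meet (forget (@Cup bool, q)) q q by rewrite /= leqnn eqxx.
have m2 : gaps_meet (forget (@Cup bool, q)) q q.+2 by rewrite /=; lia.
have e1 : in_region A l.+1 q = in_region A l.+1 q.+2.
  rewrite -(in_region_meet AP PE m1) -?(in_region_meet AP PE m2) ?width_projection //; lia.
have [->|->] : i = q \/ i = q.+1 by lia.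
  by rewrite addKn; case: s => /=.
by rewrite addnK; case: s => /=.
Qed.

Lemma boundaryP (A : {set gap P}) (c : 'I_(size P)) b p :
  onth D c = Some (Cross b, p) ->
  reflect (exists l g : nat, [/\ l = c \/ l = c.+1, p <= g <= p.+2 & in_region A l g])
          (c \in boundary_crossings A).
Proof.
move=> cE; have PE : tnth (in_tuple P) c = (Cross tt, p).
  by rewrite (tnth_nth (Cup, 0)) /= -odflt_onth (onth_projection cE).
rewrite /boundary_crossings inE inE /is_cross PE /=; apply: (iffP existsP).
  move=> [x /andP[xA]]; rewrite /gap_at_crossing PE /= => /andP[xc xp].
  exists (tag x), (tagged x); split=> //; first by case/orP: xc => /eqP; [left|right].
  by apply/existsP; exists x; rewrite xA !eqxx.
move=> [l [g [lc pg /existsP[x /and3P[xA /eqP xl /eqP xg]]]]].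
rewrite -xl in lc; rewrite -xg in pg.
exists x; rewrite xA /gap_at_crossing PE /= pg andbT.
by case: lc => /eqP ->; rewrite ?orbT.
Qed.

Lemma boundary_cross (A : {set gap P}) (c : 'I_(size P)) :
  c \in boundary_crossings A -> exists b p, onth D c = Some (Cross b, p).
Proof.
rewrite /boundary_crossings inE => /andP[+ _]; rewrite inE /is_cross.
rewrite (tnth_nth (Cup, 0)) /= -odflt_onth (onth_projection_map c).
by case: (onth D c) => [[[||b] p]|] //= _; exists b, p.
Qed.

(** A region beside a strand which is about to enter a crossing has this crossing on
    its boundary. *)
Lemma side_boundary (A : {set gap P}) s x o (c : 'I_(size P)) :
  visits D c o x -> side_in A s x -> on_strand D x -> c \in boundary_crossings A.
Proof.
move=> /andP[/eqP ac /eqP]; rewrite passageE ac.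
case cE: (onth D c) => [[[||b] p]|] //; case: ifP => // xp _ sA xD.
apply/(boundaryP A cE).
exists x.1.1, (if x.2 == s then x.1.2 else x.1.2.+1); split=> //.
  move: ac xD; rewrite /ahead /on_strand; case: x.2; first by left.
  by case: x.1.1 => [|l] /=; [rewrite widthE take0|right; rewrite -ac].
by case: ifP; lia.
Qed.

(** Each corner of a region at a crossing has the under strand on one of its two
    sides. *)
Lemma boundary_under (A : {set gap P}) (c : 'I_(size P)) :
  A \in regions P -> c \in boundary_crossings A ->
  exists y s, [/\ on_strand D y, visits D c false (back y) & side_in A s y].
Proof.
move=> AP cA; have [b [p cE]] := boundary_cross cA.
have PE := onth_projection cE; have fs := onth_fits wD cE; rewrite /= addn2 in fs.
have wS := widthS cE; rewrite /strands_after /= subnK in wS; last exact: leq_trans fs.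
pose top := (c.+1, if b then p else p.+1, true).
pose bot := (nat_of_ord c, if b then p.+1 else p, false).
have top_on : on_strand D top by rewrite /on_strand /= wS; case: (b); lia.
have bot_on : on_strand D bot by rewrite /on_strand /=; case: (b); lia.
have top_v : visits D c false (back top).
  rewrite /visits passageE /ahead /= cE eqxx /=.
  by case: (b); case: ifP => [_|]; rewrite ?eqxx ?(ltn_eqF (ltnSn p)) //; lia.
have bot_v : visits D c false (back bot).
  rewrite /visits passageE /ahead /= cE eqxx /=.
  by case: (b); case: ifP => [_|]; rewrite ?eqxx ?(gtn_eqF (ltnSn p)) //; lia.
have topP s : side_in A s top -> exists y s, [/\ on_strand D y, visits D c false (back y) & side_in A s y].
  by move=> sA; exists top, s; split; [exact: top_on|exact: top_v|exact: sA].
have botP s : side_in A s bot -> exists y s, [/\ on_strand D y, visits D c false (back y) & side_in A s y].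
  by move=> sA; exists bot, s; split; [exact: bot_on|exact: bot_v|exact: sA].
have [l [g [lc pg Ag]]] := boundaryP A cE cA.
have gE : g = p \/ g = p.+1 \/ g = p.+2 by clear -pg; lia.
have m0 : gaps_meet (forget (Cross b, p)) p p by rewrite /= leqnn eqxx.
have m2 : gaps_meet (forget (Cross b, p)) p.+2 p.+2 by apply/orP; right; rewrite addn2 leqnn eqxx.
have e0 : in_region A c p = in_region A c.+1 p.
  by apply: in_region_meet AP PE m0 _ _; rewrite width_projection ?wS ltnW // ltnW.
have e2 : in_region A c p.+2 = in_region A c.+1 p.+2.
  by apply: in_region_meet AP PE m2 _ _; rewrite width_projection ?wS.
move: (topP true) (topP false) (botP true) (botP false); rewrite /side_in /=.
move=> {topP botP}t1 t2 t3 t4.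
by case: (b) t1 t2 t3 t4 => t1 t2 t3 t4; move: Ag; case: lc => ->; case: gE => [->|[]->];
  rewrite -?e0 -?e2; auto; rewrite ?e0 ?e2; auto.
Qed.

Lemma first_passage h p b y : onth D h = Some (Cross b, p) -> on_strand D y ->
  exists k, passage D (iter k (travel D) y) != None /\
    forall j, j < k -> passage D (iter j (travel D) y) = None.
Proof.
move=> hE yD; have [k [_ kE]] := reach_passage true knotD hE yD.
have ex : exists k, passage D (iter k (travel D) y) != None by exists k; rewrite kE.
exists (ex_minn ex); case: ex_minnP => m mN min; split=> // j jm.
by apply/eqP/negPn/negP => /min; rewrite leqNgt jm.
Qed.

Lemma side_walk (A : {set gap P}) s y k : A \in regions P -> on_strand D y ->
  (forall j, j < k -> passage D (iter j (travel D) y) = None) ->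
  side_in A s y -> side_in A s (iter k (travel D) y).
Proof.
move=> AP yD none sA; elim: k none => //= k IH none.
rewrite -side_travel //; [|exact: iter_on_strand|exact: none].
by apply: IH => j jk; apply: none; exact: ltnW.
Qed.

Lemma passage_visits x : passage D x != None -> exists o, visits D (ahead x) o x.
Proof. by case E: (passage D x) => [o|] // _; exists o; rewrite /visits E !eqxx. Qed.

Lemma ahead_lt x o : visits D (ahead x) o x -> ahead x < size P.
Proof.
by move=> /andP[_ /eqP/passage_lt]; rewrite /P projectionE size_map.
Qed.

(** A strand runs along the region, on the line of any of its gaps or, if this line
    is empty, on the next one or the previous one. Following it leads to a
    crossing. *)
Lemma region_boundary (A : {set gap P}) h p b : onth D h = Some (Cross b, p) ->
  A \in regions P -> exists c, c \in boundary_crossings A.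
Proof.
move=> hE AP.
suff [y [s [yD sA]]] : exists y s, on_strand D y /\ side_in A s y.
  have [k [kN none]] := first_passage hE yD.
  have [o v] := passage_visits kN.
  exists (Ordinal (ahead_lt v)); apply: (@side_boundary A s _ o (Ordinal (ahead_lt v)) v).
    exact: side_walk none sA.
  exact: iter_on_strand.
have wide l g : in_region A l g -> g <= width D l -> 0 < width D l ->
    exists y s, on_strand D y /\ side_in A s y.
  case: g => [|g] lg gl w0; first by exists (l, 0, true), true.
  by exists (l, g, true), false.
have [x xA] := region_nonempty AP.
pose l : nat := tag x; pose g : nat := tagged x.
have lg : in_region A l g by apply/existsP; exists x; rewrite xA !eqxx.
have gl : g <= width D l by rewrite -width_projection -ltnS; exact: ltn_ord.
have ls : l <= size D.
  have := ltn_ord (tag x); rewrite ltnS -/l /P projectionE size_map; exact.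
case: (posnP (width D l)) => [w0|]; last exact: wide lg gl.
have g0 : g = 0 by lia.
rewrite {}g0 in lg gl.
have [_ D0 _] := knotD; have oD : out D 0 = 0 by move: cD; rewrite /closed tangleE => /andP[_ /eqP].
case: (ltnP l (size D)) => lD.
  case eE: (onth D l) (onthTE D l) => [e|]; rewrite lD // => _.
  have fs := onth_fits wD eE; have wS := widthS eE.
  have [p' eE'] : exists p', e = (Cup, p').
    by case: e fs {eE wS} => [[||b'] p'] /=; [exists p'|lia|lia].
  subst e; rewrite /strands_after /= in fs wS.
  apply: (wide l.+1 0); rewrite ?wS //; last lia.
  rewrite -(in_region_meet AP (onth_projection eE) (g := 0)) ?width_projection ?wS //=.
have {lD ls} lE : l = size D by lia.
have [l' l'E] : exists l', l = l'.+1 by exists l.-1; lia.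
have l'D : l' < size D by lia.
case eE: (onth D l') (onthTE D l') => [e|]; rewrite l'D // => _.
have fs := onth_fits wD eE; have wS := widthS eE.
have [eE' w2] : e = (Cap, 0) /\ width D l' = 2.
  move: wS fs; rewrite -l'E w0; case: (e) => [[||b'] p']; rewrite /strands_after /=; try lia.
  by move=> h1 h2; split; [congr pair|]; lia.
subst e; apply: (wide l' 0); rewrite ?w2 //.
by rewrite (in_region_meet AP (onth_projection eE) (j := 0)) ?width_projection -?l'E.
Qed.

Variables (h : 'I_(size D)) (p0 : nat) (b0 : bool).
Hypothesis hE : onth D h = Some (Cross b0, p0).
Hypothesis alt : alternating (crossing_change h).

Lemma passage_change x : ahead x != h -> passage (crossing_change h) x = passage D x.
Proof.
move=> xh; rewrite !passageE.
case: (ltnP (ahead x) (size D)) => xD; last first.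
  by rewrite !onth_default // size_recross.
rewrite (onth_recross _ (Ordinal xD)) /=.
case: (onth D (ahead x)) => [[[||b] p]|] //=.
by rewrite -val_eqE /= (negPf xh).
Qed.

Lemma passage_change_None x :
  passage D x = None -> passage (crossing_change h) x = None.
Proof.
rewrite !passageE; case: (ltnP (ahead x) (size D)) => xD; last first.
  by rewrite !onth_default // size_recross.
rewrite (onth_recross _ (Ordinal xD)) /=.
by case: (onth D (ahead x)) => [[[||b] p]|] //=; case: ifP.
Qed.

Lemma change_shape : same_shape (crossing_change h) D.
Proof. exact: recross_forget. Qed.

(** The crossing change affects the passages at h only, so the alternation is that of
    D wherever h is not involved. *)
Lemma passage_alternates x y o o' k : on_strand D x -> travel D x = y ->
  passage D x = Some o -> ahead x != h ->
  (forall j, j < k -> passage D (iter j (travel D) y) = None) ->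
  passage D (iter k (travel D) y) = Some o' -> ahead (iter k (travel D) y) != h ->
  o' = ~~ o.
Proof.
move=> xD xy xo xh none yo yh.
have it j : iter j (travel (crossing_change h)) x = iter j (travel D) x.
  exact: same_shape_iter change_shape.
have itS j : iter j.+1 (travel D) x = iter j (travel D) y by rewrite iterSr xy.
case: x xD xy xo xh it itS => -[l i] up xD xy xo xh it itS.
have a := alt; rewrite /alternating in a; apply: (a l i up _ k).
- by rewrite (same_shape_width _ change_shape).
- by rewrite passage_change.
- move=> [|j] // /andP[_ jk]; rewrite it itS passage_change_None //; exact: none.
- by rewrite it itS passage_change.
Qed.

Local Notation over_first := (over_first knotD hE).
Local Notation kink := (kink knotD hE).

(** If no crossing of the region is passed over first, then h is not one of them,
    and passages alternate along its boundary. Take the crossing of the region which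
    is passed over earliest: its under strand on the boundary of the region leads to
    an over passage, of a crossing which is passed over earlier, or of itself. *)
Lemma region_good (A : {set gap P}) : A \in regions P ->
  exists2 c : 'I_(size P), c \in boundary_crossings A & over_first c || kink c.
Proof.
move=> AP; have [c0 c0A] := region_boundary hE AP.
have [/existsP[c /andP[cA co]]|/existsPn none] :=
  boolP [exists c in boundary_crossings A, over_first c].
  by exists c; rewrite ?co.
case: (arg_minnP (fun c : 'I_(size P) => time knotD hE c true) c0A) => c cA cmin.
have bad c' : c' \in boundary_crossings A -> ~~ over_first c'.
  by move=> c'A; have := none c'; rewrite c'A.
have off c' : c' \in boundary_crossings A -> c' != h :> nat.
  move=> c'A; apply: contraNneq (bad c' c'A) => ->; exact: time_h0.
have [y [s [yD vy sA]]] := boundary_under AP cA.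
have [k [kN nonek]] := first_passage hE yD.
have [o v] := passage_visits kN.
set z := iter k (travel D) y in kN v *.
have zD : on_strand D z by exact: iter_on_strand.
have c'A : Ordinal (ahead_lt v) \in boundary_crossings A.
  apply: (@side_boundary A s z o (Ordinal (ahead_lt v)) v) => //.
  exact: side_walk nonek sA.
have yb : on_strand D (back y) by rewrite on_strand_back.
have /andP[/eqP ay /eqP py] := vy.
have oE : o = true.
  have xy : travel D (back (travel D (back y))) = y.
    by rewrite (travel_back cD yb).1 backK.
  have xD : on_strand D (back (travel D (back y))).
    by rewrite on_strand_back; apply: travel_on_strand.
  have /andP[_ /eqP pz] := v.
  apply: (passage_alternates (o := false) xD xy _ _ nonek pz).
  - by rewrite passage_back.
  - by rewrite (travel_back cD yb).2 ay; apply: off.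
  - exact: off _ c'A.
rewrite oE in v c'A.
have cc : crossing_at D c.
  by have [b [p cE]] := boundary_cross cA; rewrite /crossing_at cE.
have [kc|lt] := time_next (h0E := hE) cc (bad c cA) yD vy nonek v.
  by exists c; rewrite // kc orbT.
by have := cmin _ c'A; rewrite leqNgt lt.
Qed.

End Regions.

(** * Welding all crossings *)

Lemma weld_shape (D : diagram bool) (S : {set 'I_(size D)}) : same_shape (weld S) D.
Proof. exact: recross_forget. Qed.

Lemma onth_weld (D : diagram bool) (S : {set 'I_(size D)}) (h : 'I_(size D)) :
  onth (weld S) h =
  omap (fun s => (map_shape (fun b => if h \in S then None else Some b) s.1, s.2)) (onth D h).
Proof. exact: onth_recross. Qed.

Section Weld.

Variables (D : diagram bool) (h0 p0 : nat) (b0 : bool).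
Hypothesis knotD : knot_diagram D.
Hypothesis h0E : onth D h0 = Some (Cross b0, p0).

Let cD : closed D. Proof. by case: knotD. Qed.
Let wD : wf D 0. Proof. by move: cD; rewrite /closed tangleE => /andP[]. Qed.
Local Notation at_time := (at_time D h0 p0 b0).
Local Notation time := (time knotD h0E).

(** Welding leaves the slices without a crossing alone, so they may belong to the
    complement of K ([weld_keep]). *)
Definition keep (K : {set 'I_(size D)}) : wdiagram := weld (~: K).

Lemma keep_closed K : closed (keep K).
Proof. by rewrite (same_shape_closed (weld_shape _)). Qed.

Lemma keep_ok (K : {set 'I_(size D)}) x : (forall c : 'I_(size D), c \in K -> ~~ visits D c false x) ->
  travel_ok (keep K) x.
Proof.
case: x => -[l i] up ok; rewrite /travel_ok slice_aheadE.
set a := ahead _; case: (ltnP a (size D)) => aD; last first.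
  by rewrite onth_default // size_recross.
have /= -> := onth_weld (~: K) (Ordinal aD).
have := ok (Ordinal aD); rewrite /visits passageE -/a /= eqxx /=.
case: (onth D a) => [[[||b] p]|] //=; rewrite inE; case: (_ \in K) => //= /(_ isT).
by case: ifP => // _; move: (b == _) => [].
Qed.

Lemma over_exit c b p z : onth D c = Some (Cross b, p) -> on_strand D z ->
  visits D c true z ->
  back z \in [:: (c.+1, if b then p.+1 else p, true); (c, if b then p else p.+1, false)].
Proof.
move=> cE zD /andP[/eqP az /eqP]; rewrite passageE az cE.
case: z zD az => -[h i] []; rewrite /on_strand /ahead [_.1.2]/= [_.1.1]/= [_.2]/=.
  move=> _ -> /=; case: ifP => // ip [bi]; rewrite /back /= !inE; apply/orP; right.
  by apply/eqP; congr (_, _, _); move: bi; case: (b) => /=; lia.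
case: h => [|h]; first by rewrite widthE take0.
move=> _ /= -> ; case: ifP => // ip [bi]; rewrite /back /= !inE; apply/orP; left.
by apply/eqP; congr (_, _, _); move: bi; case: (b) => /=; lia.
Qed.

Lemma under_entry c b p z : onth D c = Some (Cross b, p) -> on_strand D z ->
  visits D c false z ->
  z \in [:: (c.+1, if b then p else p.+1, false); (c, if b then p.+1 else p, true)].
Proof.
move=> cE zD /andP[/eqP az /eqP]; rewrite passageE az cE.
case: z zD az => -[h i] []; rewrite /on_strand /ahead [_.1.2]/= [_.1.1]/= [_.2]/=.
  move=> _ -> /=; case: ifP => // ip [bi]; rewrite !inE; apply/orP; right.
  by apply/eqP; congr (_, _, _); move: bi; case: (b) => /=; lia.
case: h => [|h]; first by rewrite widthE take0.
move=> _ /= -> ; case: ifP => // ip [bi]; rewrite !inE; apply/orP; left.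
by apply/eqP; congr (_, _, _); move: bi; case: (b) => /=; lia.
Qed.

Lemma keep_weld (K : {set 'I_(size D)}) (c : 'I_(size D)) b p x k :
  c \in K -> onth D c = Some (Cross b, p) ->
  x \in [:: ((c : nat).+1, if b then p.+1 else p, true);
            (c : nat, if b then p else p.+1, false)] ->
  (forall j, j < k -> travel_ok (keep K) (iter j (travel D) x)) ->
  iter k (travel D) x \in [:: ((c : nat).+1, if b then p else p.+1, false);
                              (c : nat, if b then p.+1 else p, true)] ->
  eqv 0 (keep K) (keep (K :\ c)).
Proof.
move=> cK cE xP ok yP.
have sK L : size (keep L) = size D by exact: size_recross.
have cW : onth (keep K) c = Some (crossing (Some b) p) by rewrite onth_weld cE /= inE cK.
have WE : keep K = take c (keep K) ++ crossing (Some b) p :: drop c.+1 (keep K).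
  rewrite -{1}(cat_take_drop c (keep K)) (drop_nth (crossing (Some b) p)) ?sK //.
  by rewrite -odflt_onth cW.
have WE' : keep (K :\ c) = take c (keep K) ++ welded p :: drop c.+1 (keep K).
  apply: eq_from_onth => j; have [jD|jD] := ltnP j (size D); last first.
    rewrite !onth_default ?sK // size_cat /= size_take size_drop sK ltn_ord.
    by have := ltn_ord c; lia.
  have jE L : onth (keep L) j = omap (fun s => (map_shape
      (fun b => if Ordinal jD \in ~: L then None else Some b) s.1, s.2)) (onth D j).
    exact: onth_weld (Ordinal jD).
  have jE' := jE K; rewrite [LHS]jE.
  rewrite onth_cat size_take sK ltn_ord; case: (ltngtP j c) => jc.
  - move: jE'; rewrite -{1}(cat_take_drop c (keep K)) onth_cat size_take sK ltn_ord jc => ->.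
    by rewrite !inE -val_eqE /= (ltn_eqF jc).
  - move: jE'; rewrite {1}WE onth_cat size_take sK ltn_ord ltnNge (ltnW jc) /=.
    by case jcE: (j - c) => [|r] /=; [lia|move=> ->; rewrite !inE -val_eqE /= (gtn_eqF jc)].
  have -> : Ordinal jD = c by exact: val_inj.
  by rewrite jc subnn cE /= !inE eqxx.
rewrite WE'; have sc : size (take c (keep K)) = c by rewrite size_take sK ltn_ord.
have := @weld_crossing (take c (keep K)) (drop c.+1 (keep K)) b p x k.
rewrite -WE sc => /(_ (keep_closed K) xP); apply.
  by move=> j jk; rewrite (same_shape_iter _ _ (weld_shape _)); exact: ok.
by rewrite (same_shape_iter _ _ (weld_shape _)).
Qed.

Local Notation kink := (kink knotD h0E).
Local Notation over_first := (over_first knotD h0E).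

(** A kept crossing which is passed over first can be welded if it is the one
    passed under at the earliest time, since then no kept crossing is passed under
    between its two passages. *)
Lemma weld_over_first (K : {set 'I_(size D)}) (c : 'I_(size D)) b p :
  c \in K -> onth D c = Some (Cross b, p) -> over_first c ->
  (forall c' : 'I_(size D), c' \in K -> time c false <= time c' false) ->
  eqv 0 (keep K) (keep (K :\ c)).
Proof.
move=> cK cE oc min; have cc : crossing_at D c by rewrite /crossing_at cE.
have vo := time_visits knotD h0E true cc; have vu := time_visits knotD h0E false cc.
have {}oc : time c true < time c false := oc.
set o := time c true in vo oc; set u := time c false in vu oc min.
have ton t : on_strand D (at_time t) by exact: at_time_on knotD h0E t.
apply: (@keep_weld K c b p (at_time o.+1) (u - o.+1) cK cE).
- have := over_exit cE (z := back (at_time o.+1)); rewrite backK; apply.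
    by rewrite on_strand_back.
  by rewrite (visits_back knotD) // ton.
- move=> j jk; rewrite at_timeD; apply: keep_ok => c' c'K; apply/negP => v.
  by have := leq_trans (min c' c'K) (time_min knotD h0E v); rewrite leqNgt -ltn_subRL jk.
by rewrite at_timeD subnKC //; exact: under_entry vu.
Qed.

(** The loop of a kink contains no crossing at all; here it is followed backwards, as
    a kink is passed under first. *)
Lemma weld_kink (K : {set 'I_(size D)}) (c : 'I_(size D)) b p :
  c \in K -> onth D c = Some (Cross b, p) -> kink c ->
  eqv 0 (keep K) (keep (K :\ c)).
Proof.
move=> cK cE /andP[uo /forallP none]; have cc : crossing_at D c by rewrite /crossing_at cE.
have vo := time_visits knotD h0E true cc; have vu := time_visits knotD h0E false cc.
set o := time c true in vo uo none; set u := time c false in vu uo none.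
have ton t : on_strand D (at_time t) by exact: at_time_on knotD h0E t.
have itE j : j <= o -> iter j (travel D) (back (at_time o)) = back (at_time (o - j)).
  elim: j => [|j IH] jo; first by rewrite subn0.
  rewrite iterS IH; last exact: ltnW.
  rewrite -(subnSK jo); exact: (travel_back cD (ton _)).1.
apply: (@keep_weld K c b p (back (at_time o)) (o - u.+1) cK cE).
- exact: over_exit vo.
- move=> j jk; have jo : j < o by apply: leq_trans jk _; exact: leq_subr.
  rewrite itE; last exact: ltnW.
  apply: keep_ok => c' c'K; rewrite -(subnSK jo) -[at_time _.+1]/(travel D (at_time _)).
  rewrite (visits_back knotD) //; apply/negP => /andP[_].
  have lt : o - j.+1 < o by lia.
  have := none (Ordinal lt) => /implyP /=; rewrite (_ : u < o - j.+1); last lia.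
  by move=> /(_ isT)/eqP->.
rewrite itE ?leq_subr // subKn // -[at_time _.+1]/(travel D (at_time _)).
apply: under_entry cE _ _; last by rewrite (visits_back knotD).
by rewrite on_strand_back; exact: (ton u.+1).
Qed.

(** The times are those of the travel on D, which do not depend on K; so the
    crossings that remain after a welding are still good. Kinks are welded first, the
    others in the order in which they are passed under. *)
Lemma keep_good (K : {set 'I_(size D)}) :
  (forall c : 'I_(size D), c \in K -> crossing_at D c && (over_first c || kink c)) ->
  eqv 0 (keep K) (keep set0).
Proof.
elim: {K}_.+1 {-2}K (ltnSn #|K|) => // N IH K KN good.
have [->|[c0 c0K]] := set_0Vmem K; first exact: eqv_refl.
have next (c : 'I_(size D)) : c \in K -> eqv 0 (keep K) (keep (K :\ c)) ->
    eqv 0 (keep K) (keep set0).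
  move=> cK E; apply: eqv_trans E _; apply: IH.
    by move: KN; rewrite (cardsD1 c K) cK add1n ltnS.
  by move=> c' /setD1P[_ /good].
have cross (c : 'I_(size D)) : c \in K -> exists b p, onth D c = Some (Cross b, p).
  move=> /good/andP[+ _]; rewrite /crossing_at.
  by case: (onth D c) => [[[||b] p]|] // _; exists b, p.
have [/existsP[c /andP[cK kc]]|/existsPn nok] := boolP [exists c in K, kink c].
  have [b [p cE]] := cross c cK; apply: (next c cK); exact: weld_kink cE kc.
case: (arg_minnP (fun c : 'I_(size D) => time c false) c0K) => c cK' cmin.
have cK : c \in K by exact: cK'.
have [b [p cE]] := cross c cK; apply: (next c cK); apply: weld_over_first cE _ cmin => //.
by have /andP[_ /orP[//|kc]] := good c cK; have := nok c; rewrite cK kc.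
Qed.

Lemma keep_trivial (K : {set 'I_(size D)}) :
  (forall c : 'I_(size D), c \in K -> crossing_at D c && (over_first c || kink c)) ->
  welded_trivial (keep K).
Proof.
move=> good; apply: eqv_welded; first exact: keep_closed.
apply: eqv_trans (keep_good good) _; apply: welded_trivial_unclassical.
- exact: keep_closed.
- apply/(all_nthP (Cup, 0)) => l; rewrite /keep setC0 size_recross => lD.
  have := onth_weld [set: 'I_(size D)] (Ordinal lD); rewrite -odflt_onth /= => ->.
  by case: (onth D l) => [[[||b] p]|] //=; rewrite inE.
- apply: knot_colorings; apply: same_shape_knot knotD.
  exact/esym/weld_shape.
Qed.

End Weld.

(** * The bound *)

(** Triviality of a welded knot is not given as a boolean, hence the classical
    choice of a minimum. *)
Lemma least_nat (Q : nat -> Prop) n : Q n ->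
  exists m, [/\ Q m, m <= n & forall k, Q k -> m <= k].
Proof.
elim: n {-2}n (leqnn n) => [|N IH] n nN Qn.
  by exists n; split=> // k _; apply: leq_trans nN _.
have [[k [Qk kn]]|none] := classic (exists k, Q k /\ k < n).
  have [|m [Qm mk min]] := IH k _ Qk; first by rewrite -ltnS (leq_trans kn).
  by exists m; split=> //; apply: leq_trans mk _; exact: ltnW.
exists n; split=> // k Qk; rewrite leqNgt; apply/negP => kn.
by apply: none; exists k.
Qed.

Lemma crossingsE (D : diagram bool) (c : 'I_(size D)) :
  (c \in crossings D) = crossing_at D c.
Proof.
rewrite inE /is_cross /crossing_at (tnth_nth (Cup, 0)) /= -odflt_onth.
by case: (onth D c) => [[[||b] p]|].
Qed.

Lemma weld_keep (D : diagram bool) (K : {set 'I_(size D)}) :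
  weld (crossings D :\: K) = keep K.
Proof.
apply: eq_from_onth => j; have [jD|jD] := ltnP j (size D); last first.
  by rewrite !onth_default ?size_recross.
have /= -> := onth_weld (crossings D :\: K) (Ordinal jD).
have /= -> := onth_weld (~: K) (Ordinal jD).
rewrite !in_setD !in_setC crossingsE /crossing_at /=.
by case: (onth D j) => [[[||b] p]|] //=; rewrite andbT.
Qed.

Lemma isolation_attained (P : diagram unit) :
  exists2 X : {set {set gap P}}, isolated X & #|X| = isolation_number_proj P.
Proof.
have i0 : isolated (set0 : {set {set gap P}}).
  by rewrite /isolated sub0set; apply/forallP => A; rewrite inE.
have c0 : 0 < #|[pred X : {set {set gap P}} | isolated X]|.
  by apply/card_gt0P; exists set0.
have [X XI XE] := eq_bigmax_cond (fun X : {set {set gap P}} => #|X|) c0.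
by exists X => //; rewrite /isolation_number_proj -XE.
Qed.

Lemma isolated_boundary (P : diagram unit) (X : {set {set gap P}}) A B c :
  isolated X -> A \in X -> B \in X ->
  c \in boundary_crossings A -> c \in boundary_crossings B -> A = B.
Proof.
move=> /andP[_ /forallP dis] AX BX cA cB; apply/eqP/negPn/negP => AB.
have := dis A; rewrite AX => /forallP/(_ B); rewrite BX AB /= => /pred0P/(_ c).
by rewrite /= cA cB.
Qed.

Theorem corollary4 (D : diagram bool) (hD : almost_alternating D) :
  exists u : nat,
    is_welded_unknotting_number D u /\
    (u%:Z <= (crossing_number D)%:Z - (isolation_number D)%:Z)%R.
Proof.
have [knotD _ [h hc alt]] := hD.
have [b0 [p0 hE]] : exists b p, onth D h = Some (Cross b, p).
  move: hc; rewrite crossingsE /crossing_at.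
  by case: (onth D h) => [[[||b] p]|] // _; exists b, p.
pose P := projection D; have PD : size P = size D by exact: size_recross.
have [X iX XE] := isolation_attained P.
have XP A : A \in X -> A \in regions P by move: iX => /andP[/subsetP XP _]; exact: XP.
pose good (c : nat) := over_first knotD hE c || kink knotD hE c.
(* One good crossing for each region of X; they are distinct since isolated regions
   share no crossing. *)
pose g (A : {set gap P}) : 'I_(size P) :=
  odflt (cast_ord (esym PD) h) [pick c in boundary_crossings A | good c].
have gP A : A \in X -> g A \in boundary_crossings A /\ good (g A).
  move=> AX; rewrite /g; case: pickP => [c /andP[]//|none].
  have [c cA cg] := region_good knotD hE alt (XP A AX).
  by have := none c; rewrite /good /= cA cg.
pose f A := cast_ord PD (g A); pose K := [set f A | A in X].
have Kcard : #|K| = isolation_number D.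
  rewrite card_in_imset // => A B AX BX /cast_ord_inj gAB.
  apply: (isolated_boundary iX AX BX (gP A AX).1).
  by rewrite gAB; exact: (gP B BX).1.
have Kgood c : c \in K -> crossing_at D c && good c.
  move=> /imsetP[A AX ->]; have [gA ->] := gP A AX.
  have [b [p cE]] := boundary_cross gA.
  by rewrite /crossing_at /= cE.
have Ksub : K \subset crossings D.
  by apply/subsetP => c /Kgood/andP[cc _]; rewrite crossingsE.
pose Q n := exists S : {set 'I_(size D)},
  [/\ S \subset crossings D, #|S| = n & welded_trivial (weld S)].
have QK : Q #|crossings D :\: K|.
  exists (crossings D :\: K); split=> //; first exact: subsetDl.
  by rewrite weld_keep; exact: (@keep_trivial D h p0 b0 knotD hE K).
have [u [Qu uK min]] := least_nat QK.
exists u; split; first by split=> // S sS tS; apply: min; exists S.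
have IC : isolation_number D <= crossing_number D by rewrite -Kcard; exact: subset_leq_card.
move: uK; rewrite cardsD (setIidPr Ksub) Kcard -/(crossing_number D).
by move: IC; clear; lia.
Qed.
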